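(* Let $q,t\in\mathbb{C}$ be not roots of unity with $t\neq q$ and $t\ne q^{-1}$ (i.e. $qt\neq 1$), and let $c\in\mathbb{C}$, $c\neq 0$. Put $h(u)=\dfrac{1+u^3}{(1-u)(1-u^2)}$. (i) If $a_i=c^i\frac{q^i-1}{1-t^i}$ for all $i\ge 1$, then the algebra $\Lambda_{\mathbf a}$ is Cohen-Macaulay with Hilbert series $h(u)$. (ii) Let $\mathbf a=(a_1,a_2,\dots)$ be any sequence of nonzero complex numbers, and let $c,q,t$ (with $q,t$ not roots of unity and $t\ne q,q^{-1}$) be such that $a_i=c^i\frac{q^i-1}{1-t^i}$ for $i=1,2,3$. If $\Lambda_{\mathbf a}$ is Cohen-Macaulay, then $a_i=c^i\frac{q^i-1}{1-t^i}$ for all $i\ge 1$. (iii) Let $a_i=c^i a$ for all $i\ge 1$, where $a\in\mathbb{C}$, $a\neq 0$, $a\ne \pm 1$. Then $\Lambda_{\mathbf a}$ is Cohen-Macaulay with Hilbert series $h(u)$. (iv) Let $\mathbf a$ be a sequence of nonzero complex numbers with $a_i=c^ia$ for $i=1,2,3$, where $a\neq \pm1$. If $\Lambda_{\mathbf a}$ is Cohen-Macaulay, then $a_i=c^ia$ for all $i\ge 1$.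
   Context: For a sequence $\mathbf a=(a_1,a_2,\dots)$ of nonzero complex numbers, $\Lambda_{\mathbf a}$ denotes the subalgebra of $\mathbb{C}[y,z]$ generated by the polynomials $Q_i=a_iy^i+z^i$, $i\ge 1$. It is graded by the usual degree of polynomials, and its Hilbert series is $\sum_{i\geq 0}\dim(\Lambda_{\mathbf a}[i])u^i$, where $\Lambda_{\mathbf a}[i]$ is the homogeneous part of degree $i$. *)

(* Defs.v *)
From HB Require Import structures.
From mathcomp Require Import all_boot all_order all_algebra.
From mathcomp Require Import boolp reals complex mpoly.

Set Implicit Arguments.
Unset Strict Implicit.
Unset Printing Implicit Defensive.

Import GRing.Theory.

Local Open Scope ring_scope.

(* Cohen-Macaulay rings, following Eisenbud (Commutative Algebra, 18.2): a     *)
(* Noetherian commutative ring is Cohen-Macaulay when depth M = codim M for    *)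
(* every maximal ideal M; codim M is the Krull dimension of the localization   *)
(* at M.                                                                       *)
(* The library predicate idealr_closed includes 1 \notin I, so all the ideals  *)
(* below are proper.  Membership is boolean, but boolp provides [< _ >], so    *)
(* quantifying over {pred A} is quantifying over all subsets of A.             *)
Section CohenMacaulay.
Variable A : comNzRingType.
Implicit Types (I M P : {pred A}) (s : seq A).

Definition ideal_gen s (x : A) : Prop :=
  exists c : 'I_(size s) -> A, x = \sum_(i < size s) c i * s`_i.

Definition noetherian : Prop :=
  forall I, idealr_closed I -> exists s, forall x, x \in I <-> ideal_gen s x.

Definition prime_ideal P : Prop := idealr_closed P /\ prime_idealr_closed P.

Definition maximal_ideal M : Prop :=
  idealr_closed M /\
  forall I, idealr_closed I -> {subset M <= I} -> {subset I <= M}.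

Definition regular_sequence s : Prop :=
  ~ ideal_gen s 1 /\
  forall i, (i < size s)%N ->
    forall x, ideal_gen (take i s) (s`_i * x) -> ideal_gen (take i s) x.

Definition is_depth I (d : nat) : Prop :=
  (exists s, [/\ regular_sequence s, {subset s <= I} & size s = d]) /\
  (forall s, regular_sequence s -> {subset s <= I} -> (size s <= d)%N).

Definition prime_chain P (n : nat) (p : nat -> {pred A}) : Prop :=
  [/\ forall i, (i <= n)%N -> prime_ideal (p i),
      forall i, (i < n)%N ->
        {subset p i <= p i.+1} /\ ~ {subset p i.+1 <= p i}
    & p n =i P].

Definition is_codim P (d : nat) : Prop :=
  (exists p, prime_chain P d p) /\
  (forall n p, prime_chain P n p -> (n <= d)%N).

Definition cohen_macaulay : Prop :=
  noetherian /\
  forall M, maximal_ideal M -> exists d, is_depth M d /\ is_codim M d.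

End CohenMacaulay.

Section Lambda.
Variable F : fieldType.
Implicit Type a : nat -> F.

(* y = 'X_0 and z = 'X_1; the value a 0 is never used. *)
Definition Q a (i : nat) : {mpoly F[2]} :=
  a i *: 'X_(0 : 'I_2) ^+ i + 'X_(1 : 'I_2) ^+ i.

Definition in_Lambda a (p : {mpoly F[2]}) : Prop :=
  forall S : {pred {mpoly F[2]}}, GRing.subalg_closed S ->
    (forall i, (0 < i)%N -> Q a i \in S) -> p \in S.

Definition Lambda a : {pred {mpoly F[2]}} := fun p => `[< in_Lambda a p >].

Lemma Lambda_subalg a : GRing.subalg_closed (Lambda a).
Proof.
split=> [|k u v /asboolP Lu /asboolP Lv|u v /asboolP Lu /asboolP Lv];
  apply/asboolP => S S_alg SQ; have [S1 SZD SM] := S_alg.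
- exact: S1.
- by apply: SZD; [apply: Lu | apply: Lv].
- by apply: SM; [apply: Lu | apply: Lv].
Qed.

HB.instance Definition _ a :=
  GRing.isSubringClosed.Build {mpoly F[2]} (Lambda a)
    (GRing.subalg_closedBM (Lambda_subalg a)).

Record Lambda_ring a :=
  LambdaRing { Lambda_val :> {mpoly F[2]}; _ : Lambda_val \in Lambda a }.

HB.instance Definition _ a := [isSub for @Lambda_val a].
HB.instance Definition _ a := [Choice of Lambda_ring a by <:].
HB.instance Definition _ a :=
  [SubChoice_isSubComNzRing of Lambda_ring a by <:].

(* dhomog 2 F d is the library's space of degree d forms in two variables. *)
Definition hilbert_function a (H : nat -> nat) : Prop :=
  forall d, exists U : {vspace dhomog 2 F d},
    (forall p : dhomog 2 F d, (p \in U) = (mpoly_of_dhomog p \in Lambda a)) /\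
    \dim U = H d.

(* The formal power series sum_d (H d) u^d equals num / den: its product with  *)
(* den has the coefficients of num.  Meant for den with den`_0 = 1.            *)
Definition series_eq_frac (H : nat -> nat) (num den : {poly int}) : Prop :=
  forall n, \sum_(i < n.+1) den`_i * (H (n - i)%N)%:Z = num`_n.

Definition hilbert_series_eq a (num den : {poly int}) : Prop :=
  exists H, hilbert_function a H /\ series_eq_frac H num den.

Definition not_root_of_unity (x : F) : Prop :=
  forall n, (0 < n)%N -> ~~ n.-unity_root x.

End Lambda.

Definition h_num : {poly int} := 1 + 'X^3.
Definition h_den : {poly int} := (1 - 'X) * (1 - 'X^2).

(* Main.v *)
Require Import Defs.
From HB Require Import structures.
From mathcomp Require Import all_boot all_order all_algebra.
From mathcomp Require Import boolp reals complex mpoly.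
From mathcomp Require Import ring zify.

(* Let L be a linear map C[y,z] -> C[x] with L (f g) = e1 f * L g + L f * e2 g *)
(* for two parametrised lines e1, e2 through the origin: in the (q,t) case     *)
(* L f = f(x/c, x) - f(t x/c, q x), in the confluent case a directional        *)
(* derivative along the line (x/c, x).  The equation L Q_i = 0 is exactly the  *)
(* formula for a_i.  Over P = C[Q_1, Q_2], C[y,z] is generated by 1 and y, and *)
(* if L Q_3 = 0, then ker L = P + P Q_3; so L Q_1 = L Q_2 = L Q_3 = 0 implies  *)
(* that ker L is contained in Lambda_a.                                        *)
(*                                                                             *)
(* If all L Q_i vanish, then Lambda_a = ker L, which has codimension one in    *)
(* each positive degree.  Every maximal ideal contains some Q_1 - al and       *)
(* Q_2 - be (Nullstellensatz for P, Lambda_a being integral over P), and these *)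
(* form a regular sequence; three elements of C[y,z] are algebraically         *)
(* dependent, which bounds both depth and codimension by 2.                    *)
(*                                                                             *)
(* Conversely, if L Q_n <> 0, then Lambda_a contains all forms of degree at    *)
(* least n.  A form f of largest degree not in Lambda_a is multiplied into     *)
(* Lambda_a by the irrelevant ideal, which therefore has depth at most 1,      *)
(* whereas its codimension is at least 2.                                      *)

(** The crux is [kerL_form]: the vanishing of L on Q_1, Q_2, Q_3 alone forces ker L into Lambda. If
    L kills every Q_k, the twisted Leibniz rule gives the reverse inclusion ([Lambda_kerL]). Since L
    sends a form of degree d to a multiple of x^d and, for d > 0, does not kill Q_1^(d-1) y, the
    graded dimensions are 1, 1, 2, 3, 4, ..., the coefficients of h ([Lambda_hilbert_series]). For
    depth and codimension at least 2 the decisive fact is [line_ideal]: in Lambda, Q_1 - al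
    generates the prime ideal of the elements vanishing on a line, and Q_2 - be does not vanish on
    that line. For the upper bounds, [mpoly2_dep] yields the elementary identity [lex_dep], which
    bounds prime chains and regular sequences alike. In the converse, one n with L Q_n nonzero
    supplies, through Q_1^(k-n) Q_n, the dimension missing in every degree k >= n
    ([kernel_of_cohen_macaulay]). Then Lambda has finite codimension in C[y,z] but misses y, so its
    depth at the origin is too small ([Lambda_not_cohen_macaulay]). The two families differ only in
    the choice of L; the conditions on the parameters supply the nonvanishing hypotheses of the
    general argument. *)

Set Implicit Arguments.
Unset Strict Implicit.
Unset Printing Implicit Defensive.

Import GRing.Theory Num.Theory.

Local Open Scope ring_scope.

(** * Ideals and the Hilbert basis theorem *)

Section IdealGen.
Variable A : comNzRingType.
Implicit Types (I M P : {pred A}) (s : seq A) (x y : A).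

Lemma ideal_gen0 s : ideal_gen s 0.
Proof. by exists (fun=> 0); rewrite big1 // => i _; rewrite mul0r. Qed.

Lemma ideal_genD s x y : ideal_gen s x -> ideal_gen s y -> ideal_gen s (x + y).
Proof.
move=> [c ->] [d ->]; exists (fun i => c i + d i); rewrite -big_split.
by apply: eq_bigr => i _; rewrite mulrDl.
Qed.

Lemma ideal_genM s a x : ideal_gen s x -> ideal_gen s (a * x).
Proof.
move=> [c ->]; exists (fun i => a * c i); rewrite mulr_sumr.
by apply: eq_bigr => i _; rewrite mulrA.
Qed.

Lemma ideal_genN s x : ideal_gen s x -> ideal_gen s (- x).
Proof. by move=> sx; rewrite -mulN1r; apply: ideal_genM. Qed.

Lemma ideal_gen_sum s n (f : 'I_n -> A) :
  (forall i, ideal_gen s (f i)) -> ideal_gen s (\sum_i f i).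
Proof.
move=> sf; apply: (big_ind (ideal_gen s)) => // [|x y]; first exact: ideal_gen0.
exact: ideal_genD.
Qed.

Lemma ideal_gen_mem s x : x \in s -> ideal_gen s x.
Proof.
move=> xs; have ltxs : (index x s < size s)%N by rewrite index_mem.
exists (fun i => (i == Ordinal ltxs)%:R); rewrite (bigD1 (Ordinal ltxs)) //=.
rewrite eqxx mul1r nth_index // big1 ?addr0 // => i /negPf ->.
by rewrite mul0r.
Qed.

Lemma ideal_gen_trans s s' x :
  {in s, forall y, ideal_gen s' y} -> ideal_gen s x -> ideal_gen s' x.
Proof.
move=> ss' [c ->]; apply: ideal_gen_sum => i.
by apply: ideal_genM; apply: ss'; apply: mem_nth.
Qed.

Lemma ideal_gen_nil x : ideal_gen [::] x <-> x = 0.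
Proof.
split=> [[c ->]|->]; last exact: ideal_gen0.
by rewrite big_ord0.
Qed.

Lemma ideal_gen1P y x : ideal_gen [:: y] x <-> exists c, x = c * y.
Proof.
split=> [[c ->]|[c ->]]; first by exists (c ord0); rewrite big_ord1.
by apply: ideal_genM; apply: ideal_gen_mem; rewrite mem_head.
Qed.

Lemma ideal_sub I s x : idealr_closed I -> {subset s <= I} ->
  ideal_gen s x -> x \in I.
Proof.
move=> [I0 _ IM] sI [c ->].
apply: (big_ind (fun y => y \in I)) => // [y z Iy Iz|i _].
  by rewrite -[y]mul1r IM.
by rewrite -[_ * _]addr0 IM // sI // mem_nth.
Qed.

Section IdealClosed.
Variable I : {pred A}.
Hypothesis I_ideal : idealr_closed I.

Lemma ideal_addr x y : x \in I -> y \in I -> x + y \in I.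
Proof. by case: I_ideal => _ _ IM Ix Iy; rewrite -[x]mul1r IM. Qed.

Lemma ideal_mull a x : x \in I -> a * x \in I.
Proof. by case: I_ideal => I0 _ IM Ix; rewrite -[a * x]addr0 IM. Qed.

Lemma ideal_mulr a x : x \in I -> x * a \in I.
Proof. by rewrite mulrC; apply: ideal_mull. Qed.

Lemma ideal_subr x y : x \in I -> y \in I -> x - y \in I.
Proof. by move=> Ix Iy; rewrite -mulN1r ideal_addr // ideal_mull. Qed.

End IdealClosed.

Lemma prime_mem_mul P x y : prime_ideal P -> x * y \in P -> x \notin P -> y \in P.
Proof. by move=> [_ Pp] /Pp /orP[-> //|]. Qed.

Lemma prime_mem_expr P x n y : prime_ideal P -> x ^+ n * y \in P -> x \notin P ->
  y \in P.
Proof.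
move=> Pp Pxy Px; elim: n Pxy => [|n IHn]; first by rewrite expr0 mul1r.
by rewrite exprS -mulrA => /(prime_mem_mul Pp) /(_ Px).
Qed.

Lemma maximal_ideal_inv M x : maximal_ideal M -> x \notin M ->
  exists g, g * x - 1 \in M.
Proof.
move=> [M_id Mmax] Mx; apply: contrapT => Ngx.
(* [J] is M + (x); it is proper because no multiple of x is 1 modulo M, so maximality puts x in
   M. *)
pose J : {pred A} := fun y => `[< exists g, y - g * x \in M >].
have J_id : idealr_closed J.
  have [M0 M1 MM] := M_id; split.
  - by apply/asboolP; exists 0; rewrite mul0r subr0.
  - apply/asboolP => -[g Mg]; apply: Ngx; exists g.
    by rewrite -opprB -mulN1r ideal_mull.
  - move=> a u v /asboolP[g Mg] /asboolP[h Mh]; apply/asboolP.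
    exists (a * g + h).
    by have -> : a * u + v - (a * g + h) * x = a * (u - g * x) + (v - h * x);
      [ring | rewrite MM].
have /negP := Mx; apply; apply: (Mmax _ J_id).
  by move=> y My; apply/asboolP; exists 0; rewrite mul0r subr0.
by apply/asboolP; exists 1; rewrite mul1r subrr; case: M_id.
Qed.

Lemma maximal_ideal_prime M : maximal_ideal M -> prime_ideal M.
Proof.
move=> Mmax; split=> [|u v Muv]; first by case: Mmax.
have [//|Mu] := boolP (u \in M); have [g Mg] := maximal_ideal_inv Mmax Mu.
have M_id := Mmax.1; rewrite -[v](_ : g * (u * v) - v * (g * u - 1) = v); last by ring.
by rewrite /= ideal_subr // ideal_mull.
Qed.

End IdealGen.

Lemma ker_prime (A : comNzRingType) (B : idomainType) (f : {rmorphism A -> B}) :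
  prime_ideal (fun x => f x == 0).
Proof.
split; first split.
- by rewrite unfold_in rmorph0.
- by rewrite unfold_in rmorph1 oner_neq0.
- by move=> a u v; rewrite !unfold_in rmorphD rmorphM => /eqP-> /eqP->; rewrite mulr0 addr0.
- by move=> u v; rewrite !unfold_in rmorphM mulf_eq0.
Qed.

Lemma preim_ideal (A B : comNzRingType) (f : {rmorphism A -> B}) (I : {pred B}) :
  idealr_closed I -> idealr_closed (fun x => f x \in I).
Proof.
move=> [I0 I1 IM]; split; first by rewrite unfold_in rmorph0.
  by rewrite unfold_in rmorph1.
by move=> a u v; rewrite !unfold_in rmorphD rmorphM; apply: IM.
Qed.

Section Noetherian.

Lemma mkseqP (T : eqType) (l : nat -> T) n y :
  reflect (exists2 i, (i < n)%N & y = l i) (y \in mkseq l n).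
Proof.
apply: (iffP mapP) => [[k]|[k ltkn ->]]; last by exists k; rewrite ?mem_iota.
by rewrite mem_iota => /= ltkn ->; exists k.
Qed.

Lemma ideal_gen_mkseq (A : comNzRingType) (l : nat -> A) i n : (i < n)%N ->
  ideal_gen (mkseq l n) (l i).
Proof. by move=> ltin; apply/ideal_gen_mem/mkseqP; exists i. Qed.

Lemma field_noetherian (F : fieldType) : noetherian F.
Proof.
move=> I [I0 I1 IM]; exists [::] => x; rewrite ideal_gen_nil; split=> [Ix|->//].
apply/eqP; apply: contraNT I1 => x0.
by rewrite -[1]addr0 -(mulVf x0) IM.
Qed.

Lemma noetherian_surj (A B : comNzRingType) (f : {rmorphism A -> B}) :
  (forall y, exists x, f x = y) -> noetherian A -> noetherian B.
Proof.
move=> f_surj noethA I I_id.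
have [s sP] := noethA _ (preim_ideal f I_id); exists (map f s) => y.
split=> [Iy|]; last first.
  apply: ideal_sub => // z /mapP[x xs ->].
  by have /sP := ideal_gen_mem xs.
have [x fx] := f_surj y; move: Iy; rewrite -fx => /sP[c xE].
rewrite xE rmorph_sum; apply: ideal_gen_sum => i; rewrite rmorphM.
by apply: ideal_genM; apply: ideal_gen_mem; apply: map_f; apply: mem_nth.
Qed.

(** The ascending chain condition: the union of the ideals generated by initial segments is finitely
    generated, and its generators already lie in one of them. The case where a segment generates 1
    is separate, because the union must be proper. *)
Lemma noetherian_seq (A : comNzRingType) (l : nat -> A) : noetherian A ->
  exists N, ideal_gen (mkseq l N) (l N).
Proof.
move=> noethA.
have mono m n x : (m <= n)%N -> ideal_gen (mkseq l m) x -> ideal_gen (mkseq l n) x.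
  move=> lemn; apply: ideal_gen_trans => y /mkseqP[i ltim ->].
  exact: ideal_gen_mkseq (leq_trans ltim lemn).
have [[N N1]|N1] := pselect (exists N, ideal_gen (mkseq l N) 1).
  by exists N; rewrite -[l N]mulr1; apply: ideal_genM.
pose J : {pred A} := fun x => `[< exists N, ideal_gen (mkseq l N) x >].
have J_id : idealr_closed J.
  split; first by apply/asboolP; exists 0%N; apply: ideal_gen0.
    by apply/asboolP.
  move=> a u v /asboolP[m mu] /asboolP[n nv]; apply/asboolP; exists (maxn m n).
  apply: ideal_genD; last exact: mono (leq_maxr _ _) nv.
  by apply: ideal_genM; apply: mono (leq_maxl _ _) mu.
have [s sP] := noethA _ J_id.
have [N sN] : exists N, {in s, forall y, ideal_gen (mkseq l N) y}.
  have: {subset s <= J} by move=> y /ideal_gen_mem /sP.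
  elim: s {sP} => [|y s IHs] ysJ; first by exists 0%N.
  have [|N sN] := IHs; first by move=> z zs; apply: ysJ; rewrite inE zs orbT.
  have /asboolP[m ym] := ysJ y (mem_head _ _); exists (maxn m N) => z.
  rewrite inE => /predU1P[->|/sN]; last by apply: mono; apply: leq_maxr.
  exact: mono (leq_maxl _ _) ym.
exists N; apply: (ideal_gen_trans sN); apply/sP/asboolP; exists N.+1.
exact: ideal_gen_mkseq.
Qed.

(* Choose f_N of least degree in I outside (f_0, ..., f_(N-1)); if the leading *)
(* coefficient of f_N is a combination of the earlier ones, f_N can be lowered *)
(* modulo the earlier ones, which is impossible.                               *)
Theorem hilbert_basis (A : comNzRingType) : noetherian A -> noetherian {poly A}.
Proof.
move=> noethA I I_id; apply: contrapT => Nfg.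
have next (s : seq {poly A}) : exists f : {poly A}, {subset s <= I} ->
    [/\ f \in I, ~ ideal_gen s f
      & forall g, g \in I -> ~ ideal_gen s g -> (size f <= size g)%N].
  have [sI|NsI] := pselect {subset s <= I}; last by exists 0.
  have [f0 If0 Nsf0] : exists2 f, f \in I & ~ ideal_gen s f.
    apply: contrapT => Nf; apply: Nfg; exists s => f; split; last exact: ideal_sub.
    by move=> If; apply: contrapT => Nsf; apply: Nf; exists f.
  pose S n := `[< exists f : {poly A}, [/\ f \in I, ~ ideal_gen s f & size f = n] >].
  have exS : exists n, S n by exists (size f0); apply/asboolP; exists f0.
  case: (ex_minnP exS) => n /asboolP[f [If Nsf szf]] minn; exists f => _.
  split=> // g Ig Nsg; rewrite szf; apply: minn; apply/asboolP; by exists g.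
have [pick pickP] := choice next.
pose s := fix s n := if n is m.+1 then rcons (s m) (pick (s m)) else [::].
pose f n := pick (s n).
have sE n : s n = mkseq f n.
  by elim: n => // n IHn; rewrite mkseqS -IHn.
have sI n : {subset s n <= I}.
  elim: n => //= n IHn g; rewrite mem_rcons inE => /predU1P[->|/IHn//].
  by have [] := pickP _ IHn.
have [N] := noetherian_seq (fun n => lead_coef (f n)) noethA.
case; rewrite size_mkseq => c lE.
have [IfN NsN minN] := pickP _ (sI N); apply: (NsN).
have szf (i : 'I_N) : (size (f i) <= size (f N))%N.
  have [_ _ mini] := pickP _ (sI i); apply: mini => // Nsi; apply: NsN.
  apply: ideal_gen_trans Nsi => g; rewrite !sE => /mkseqP[j ltji ->].
  exact: ideal_gen_mkseq (ltn_trans ltji (ltn_ord i)).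
pose h := \sum_(i < N) (c i)%:P * 'X^(size (f N) - size (f i)) * f i.
have hs : ideal_gen (s N) h.
  apply: ideal_gen_sum => i; apply: ideal_genM.
  by rewrite sE; apply: ideal_gen_mkseq.
rewrite -(subrK h (pick _)); apply: (ideal_genD _ hs); apply: contrapT => Ng.
have fN0 : f N != 0 by apply/eqP => fN0; apply: NsN; rewrite -/(f N) fN0; apply: ideal_gen0.
have: (size (f N - h)%R < size (f N))%N.
  rewrite -(prednK (n := size (f N))) ?size_poly_gt0 // ltnS.
  apply/leq_sizeP => j lej; rewrite coefB coef_sum; apply/eqP; rewrite subr_eq0.
  move: lej; rewrite leq_eqVlt => /predU1P[<-|ltj].
    rewrite -/(lead_coef (f N)) lE; apply/eqP/eq_bigr => i _.
    rewrite nth_mkseq // -mulrA coefCM coefXnM lead_coefE.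
    have [fi0|fi0] := eqVneq (size (f i)) 0%N.
      by rewrite !nth_default ?fi0 // if_same mulr0.
    have := szf i; case: ltnP => [|_ lef]; first by lia.
    congr (_ * _`_ _); move: (size (f i)) (size (f N)) fi0 lef => u v; lia.
  rewrite nth_default; last exact: leq_trans (leqSpred _) ltj.
  rewrite big1 // => i _; rewrite -mulrA coefCM coefXnM; have := szf i => lef.
  rewrite nth_default ?if_same ?mulr0 //.
  move: (size (f i)) (size (f N)) lef ltj => u v; lia.
rewrite ltnNge minN //; apply: (ideal_subr I_id) => //.
exact: ideal_sub I_id (sI N) hs.
Qed.

End Noetherian.

(** * Evaluation and algebraic dependence *)

Section PolyEval.
Variables (A B : comNzRingType) (f : {rmorphism A -> B}) (x : B).

Definition peval : {poly A} -> B := horner_morph (fun a => mulrC x (f a)).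

HB.instance Definition _ := GRing.RMorphism.on peval.

Lemma pevalC a : peval a%:P = f a.
Proof. exact: horner_morphC. Qed.

Lemma pevalX : peval 'X = x.
Proof. exact: horner_morphX. Qed.

Lemma pevalMXD p c : peval (p * 'X + c%:P) = peval p * x + f c.
Proof. by rewrite rmorphD rmorphM /= pevalC pevalX. Qed.

Lemma peval_poly n (E : nat -> A) :
  peval (\poly_(i < n) E i) = \sum_(i < n) f (E i) * x ^+ i.
Proof.
rewrite poly_def rmorph_sum; apply: eq_bigr => i _.
by rewrite -mul_polyC rmorphM rmorphXn /= pevalC pevalX.
Qed.

(** Factor out of p the largest power of the variable; a is the lowest nonzero coefficient. *)
Lemma peval_lowest (p : {poly A}) : p != 0 ->
  exists n a q, a != 0 /\ peval p = x ^+ n * (f a + x * q).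
Proof.
move=> p0; have exn : exists n, p`_n != 0.
  by exists (size p).-1; rewrite -lead_coefE lead_coef_eq0.
case: (ex_minnP exn) => n pn0 minn; exists n, p`_n.
have [q pE] : exists q, p = 'X^n * ((p`_n)%:P + 'X * q).
  exists (\poly_(k < size p) p`_(n + k.+1)); apply/polyP => k.
  rewrite coefXnM; case: ltnP => [ltkn|lenk].
    by apply/eqP; apply: contraTT ltkn => /minn; rewrite -leqNgt.
  rewrite coefD coefC coefXM; case: posnP => [kn0|kn_gt0].
    by rewrite addr0; congr _`_ _; lia.
  rewrite add0r coef_poly; case: ltnP => lek; first by congr _`_ _; lia.
  by rewrite nth_default //; move: (size p) lek => l; lia.
exists (peval q); split=> //.
rewrite [in LHS]pE rmorphM rmorphXn rmorphD rmorphM /=.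
by rewrite pevalC !pevalX.
Qed.

End PolyEval.

Lemma peval_morph (A B C : comNzRingType) (f : {rmorphism A -> B})
    (f' : {rmorphism A -> C}) (g : {rmorphism B -> C}) x :
  (forall a, g (f a) = f' a) -> forall p, g (peval f x p) = peval f' (g x) p.
Proof.
move=> gf; elim/poly_ind => [|p c IHp]; first by rewrite !rmorph0.
by rewrite !pevalMXD rmorphD rmorphM /= IHp gf.
Qed.

Section LexDep.
Variable A : comNzRingType.
Implicit Types (P : {pred A}) (s : seq A).

(** Required of all triples, this is the elementary form of Krull dimension at most 2. It is a
    polynomial relation read from its lexicographically lowest monomial, normalised to coefficient
    1. *)
Definition lex_dep (x y z : A) := exists k m n u v w,
  x ^+ k * (y ^+ m * (z ^+ n * (1 + z * u) + y * v) + x * w) = 0.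

Hypothesis dep : forall x y z, lex_dep x y z.

(* Coquand-Lombardi: peel the relation from the outside, cancelling at each    *)
(* level the power of an element that does not lie in the current prime.       *)
Lemma lex_dep_prime_chain P n p : prime_chain P n p -> (n <= 2)%N.
Proof.
move=> [p_prime p_lt _]; rewrite leqNgt; apply/negP => lt2n.
have pick j : (j < n)%N -> exists x, x \in p j.+1 /\ x \notin p j.
  move=> /p_lt[_ Npj]; apply: contrapT => Nx; apply: Npj => x pjx.
  by apply: contrapT => /negP Npx; apply: Nx; exists x.
have [|x [p1x p0x]] := pick 0%N; first by lia.
have [|y [p2y p1y]] := pick 1%N; first by lia.
have [|z [p3z p2z]] := pick 2%N; first by lia.
have step j e c a b : (j < n)%N -> c \in p j.+1 -> c \notin p j ->
    c ^+ e * (a + c * b) \in p j -> a \in p j.+1.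
  move=> ltjn c_in c_out /(prime_mem_expr (p_prime _ (ltnW ltjn))) /(_ c_out).
  have [p_id _] := p_prime _ ltjn.
  move/(p_lt _ ltjn).1 => /(ideal_subr p_id) /(_ (ideal_mulr p_id b c_in)).
  by rewrite addrK.
have [k [m [l [u [v [w xyz]]]]]] := dep x y z.
have: x ^+ k * (y ^+ m * (z ^+ l * (1 + z * u) + y * v) + x * w) \in p 0%N.
  by rewrite xyz; have [[]] := p_prime _ (leq0n n).
move/(step _ _ _ _ _ (ltnW (ltnW lt2n)) p1x p0x).
move/(step _ _ _ _ _ (ltnW lt2n) p2y p1y)/(step _ _ _ _ _ lt2n p3z p2z).
by have [[_ /negP]] := p_prime _ lt2n.
Qed.

(** The relation is peeled as for prime chains, now modulo the ideals of initial segments: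
    regularity cancels each power, and 1 ends up in the ideal of the first three elements. *)
Lemma lex_dep_regular s : regular_sequence s -> (size s <= 2)%N.
Proof.
case: s => [|x [|y [|z s]]] // [Ns1 reg]; exfalso; apply: Ns1.
have [k [m [l [u [v [w xyz]]]]]] := dep x y z.
have cancel j n b : (j < size [:: x, y, z & s])%N ->
    ideal_gen (take j [:: x, y, z & s]) ([:: x, y, z & s]`_j ^+ n * b) ->
    ideal_gen (take j [:: x, y, z & s]) b.
  move=> ltj; elim: n => [|n IHn]; first by rewrite mul1r.
  by rewrite exprS -mulrA => /(reg _ ltj).
have drop j a b : (j < size [:: x, y, z & s])%N ->
    ideal_gen (take j [:: x, y, z & s]) (a + [:: x, y, z & s]`_j * b) ->
    ideal_gen (take j.+1 [:: x, y, z & s]) a.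
  move=> ltj Hab; rewrite -(addrK ([:: x, y, z & s]`_j * b) a).
  apply: ideal_genD.
    apply: ideal_gen_trans Hab => c cs; apply: ideal_gen_mem.
    by rewrite (take_nth 0) // mem_rcons inE cs orbT.
  apply: ideal_genN; rewrite mulrC; apply: ideal_genM; apply: ideal_gen_mem.
  by rewrite (take_nth 0) // mem_rcons mem_head.
have := ideal_gen0 ([::] : seq A); rewrite -xyz.
move/(cancel 0%N _ _ isT)/(drop 0%N _ _ isT).
move/(cancel 1%N _ _ isT)/(drop 1%N _ _ isT).
move/(cancel 2%N _ _ isT)/(drop 2%N _ _ isT).
apply: ideal_gen_trans => c cs; apply: ideal_gen_mem.
by rewrite -(cat_take_drop 3 [:: x, y, z & s]) mem_cat cs.
Qed.

End LexDep.

Lemma poly3_lex_dep (F : fieldType) (A : comNzRingType) (f : {rmorphism F -> A})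
    (x y z : A) (p : {poly {poly {poly F}}}) :
  p != 0 -> peval (peval (peval f z) y) x p = 0 -> lex_dep x y z.
Proof.
move=> p0; have [k [q [w [q0 -> /=]]]] := peval_lowest (peval (peval f z) y) x p0.
have [m [r [v [r0 -> /=]]]] := peval_lowest (peval f z) y q0.
have [n [c [u [c0 -> /=]]]] := peval_lowest f z r0.
have fcV : f c^-1 * f c = 1 by rewrite -rmorphM mulVf ?rmorph1.
move=> xyz; exists k, m, n, (f c^-1 * u), (f c^-1 * v), (f c^-1 * w).
rewrite -(mulr0 (f c^-1)) -xyz -fcV; ring.
Qed.

Lemma msize_mul_le (F : fieldType) n (p q : {mpoly F[n]}) a b :
  (msize p <= a.+1)%N -> (msize q <= b.+1)%N -> (msize (p * q) <= (a + b).+1)%N.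
Proof.
have [->|p0] := eqVneq p 0; first by rewrite mul0r msize0.
have [->|q0] := eqVneq q 0; first by rewrite mulr0 msize0.
by rewrite msizeM //; move: (msize p) (msize q) => u v; lia.
Qed.

Lemma msize_exp_le (F : fieldType) n (p : {mpoly F[n]}) a k :
  (msize p <= a.+1)%N -> (msize (p ^+ k) <= (k * a).+1)%N.
Proof.
move=> pa; elim: k => [|k IHk]; first by rewrite expr0 msize1.
by rewrite exprS mulSn msize_mul_le.
Qed.

Lemma row_family_dep (F : fieldType) (T : finType) n (g : T -> 'rV[F]_n) :
  (n < #|T|)%N -> exists c : T -> F, (exists t, c t != 0) /\ \sum_t c t *: g t = 0.
Proof.
move=> ltnT; pose G := \matrix_(k < #|T|) g (enum_val k).
have : kermx G != 0.
  rewrite -mxrank_eq0 mxrank_ker -lt0n subn_gt0.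
  exact: leq_ltn_trans (rank_leq_col G) ltnT.
move=> /rowV0Pn[v /sub_kermxP vG v0]; exists (fun t => v 0 (enum_rank t)); split.
  have /rV0Pn[k vk] := v0; by exists (enum_val k); rewrite enum_valK.
rewrite -[RHS]vG mulmx_sum_row (reindex (@enum_val T predT)) /=; last first.
  by apply: onW_bij; apply: enum_val_bij.
by apply: eq_bigr => k _; rewrite enum_valK rowK.
Qed.

(** Counting: the N^3 products x^i y^j z^k with i, j, k < N involve only monomials with both
    exponents below K = N (3 D + 1). There are K^2 such monomials, and N > (3 D + 1)^2 gives N^3 >
    K^2. *)
Lemma mpoly2_dep (F : fieldType) (x y z : {mpoly F[2]}) :
  exists2 p : {poly {poly {poly F}}}, p != 0 &
    peval (peval (peval (@mpolyC 2 F) z) y) x p = 0.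
Proof.
pose D := (msize x + msize y + msize z)%N; pose N := ((3 * D).+1 ^ 2).+1.
pose K := (N * (3 * D).+1)%N.
pose mon (k : 'I_K * 'I_K) : 'X_{1..2} := [multinom nth 0%N [:: val k.1; val k.2] u | u < 2].
pose g (k : 'I_N * 'I_N * 'I_N) := x ^+ k.1.1 * (y ^+ k.1.2 * z ^+ k.2).
have gK k : (msize (g k) <= K)%N.
  have le a : (a <= D -> a <= D.+1)%N by lia.
  have : (msize (g k) <= (k.1.1 * D + (k.1.2 * D + k.2 * D)).+1)%N.
    by do 2?apply: msize_mul_le; apply: msize_exp_le; apply: le; rewrite /D;
       move: (msize x) (msize y) (msize z); lia.
  move/leq_trans; apply; rewrite /K; move: (ltn_ord k.1.1) (ltn_ord k.1.2) (ltn_ord k.2).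
  by move: (val k.1.1) (val k.1.2) (val k.2) => /= a b c; clear; nia.
have [|c [[t ct0] cg]] := @row_family_dep F ('I_N * 'I_N * 'I_N)%type #|{: 'I_K * 'I_K}|
    (fun k => \row_l (g k)@_(mon (enum_val l))).
  rewrite !card_prod !card_ord /K /N; clear; move: ((3 * D).+1) => u; nia.
have {}cg : \sum_k c k *: g k = 0.
  apply/mpolyP => m; rewrite mcoeff0.
  have [Km|ltmK] := leqP K (mdeg m).
    rewrite raddf_sum big1 // => k _ /=; rewrite mcoeffZ.
    by rewrite (memN_msupp_eq0 (msize_mdeg_ge _)) ?mulr0 // (leq_trans (gK k)).
  have lt0 (u : 'I_2) : (m u < K)%N.
    by apply: leq_ltn_trans ltmK; rewrite mdegE (bigD1 u) //= leq_addr.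
  have -> : m = mon (Ordinal (lt0 ord0), Ordinal (lt0 ord_max)).
    by apply/mnmP => -[[|[|//]] ltu]; rewrite mnmE /=; congr (m _); apply: val_inj.
  move/rowP/(_ (enum_rank (Ordinal (lt0 ord0), Ordinal (lt0 ord_max)))): cg.
  rewrite summxE mxE => cg; rewrite raddf_sum /= -[RHS]cg; apply: eq_bigr => k _.
  by rewrite mcoeffZ !mxE enum_rankK.
pose o k := inord k : 'I_N.
exists (\poly_(i < N) \poly_(j < N) \poly_(k < N) c (o i, o j, o k)).
  apply: contraNneq ct0 => /(congr1 (fun p : {poly {poly {poly F}}} => p`_t.1.1`_t.1.2`_t.2)).
  rewrite !coef0 !(coef_poly, ltn_ord) /o !inord_val => <-.
  by case: (t) => -[].
rewrite -[RHS]cg peval_poly.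
transitivity (\sum_i \sum_j \sum_k c (i, j, k) *: g (i, j, k)); last first.
  rewrite pair_bigA pair_bigA /=.
  by apply: eq_bigr => -[[i1 j1] k1].
apply: eq_bigr => i1 _; rewrite /= peval_poly mulr_suml; apply: eq_bigr => j1 _.
rewrite /= peval_poly !mulr_suml; apply: eq_bigr => k1 _.
rewrite /= /o !inord_val -mul_mpolyC /g /=; ring.
Qed.

(** * A Nullstellensatz in two variables *)

(** Over an algebraically closed field p is a nonzero constant times linear factors, and a prime
    ideal containing the product contains one of them. *)
Lemma prime_split_poly (F : closedFieldType) (A : comNzRingType)
    (h : {rmorphism {poly F} -> A}) (M : {pred A}) p :
  prime_ideal M -> p != 0 -> h p \in M -> exists al, h ('X - al%:P) \in M.
Proof.
move=> M_prime p0; have M_id := M_prime.1.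
have [r ->] := closed_field_poly_normal p; rewrite -mul_polyC rmorphM.
move/(prime_mem_mul M_prime) => Mr.
have {Mr} : h (\prod_(z <- r) ('X - z%:P)) \in M.
  apply: Mr; apply/negP => /(ideal_mull M_id (h (lead_coef p)^-1%:P)).
  rewrite -rmorphM -polyCM mulVf ?lead_coef_eq0 // rmorph1.
  by case: M_id => _ /negP.
elim: r => [|al r IHr]; first by rewrite big_nil rmorph1; case: M_id => _ /negP.
rewrite big_cons rmorphM; have [Mal _|Nal] := boolP (h ('X - al%:P) \in M).
  by exists al.
by move/(prime_mem_mul M_prime)/(_ Nal).
Qed.

(* In a nonzero ideal M of F[s][t] choose f of least degree in t, and suppose  *)
(* that this degree is positive.  Dividing the relation g (s - al) = 1 modulo  *)
(* M by f in F(s)[t] shows that al is a root of the leading coefficient of f.  *)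
Lemma bipoly_meet_const (F : closedFieldType) (M : {pred {poly {poly F}}}) :
  prime_ideal M ->
  (forall p, p \notin M -> exists g, g * p - 1 \in M) ->
  exists2 p : {poly F}, p != 0 & p%:P \in M.
Proof.
move=> M_prime M_inv; have M_id := M_prime.1; apply: contrapT => NM.
have M_const p : p%:P \in M -> p = 0.
  by move=> Mp; apply/eqP; apply: contrapT => /negP p0; apply: NM; exists p.
have [f0 Mf0 f0_neq0] : exists2 f, f \in M & f != 0.
  have [g Mg] : exists g, g * 'X%:P - 1 \in M.
    by apply: M_inv; apply/negP => /M_const /eqP; rewrite polyX_eq0.
  exists (g * 'X%:P - 1) => //; apply/eqP => /(congr1 (fun p : {poly {poly F}} => (p`_0).[0])).
  rewrite coefB coefMC coef1 coef0 horner0 hornerD hornerM hornerX mulr0 add0r.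
  by rewrite hornerN hornerC => /eqP; rewrite oppr_eq0 oner_eq0.
pose S n := `[< exists f : {poly {poly F}}, [/\ f \in M, f != 0 & size f = n] >].
have exS : exists n, S n by exists (size f0); apply/asboolP; exists f0.
case: (ex_minnP exS) => n /asboolP[f [Mf f_neq0 szf]] minn.
have minf g : g \in M -> (size g < n)%N -> g = 0.
  move=> Mg; rewrite ltnNge => ltgn; apply/eqP; apply: contraNT ltgn => g0.
  by apply: minn; apply/asboolP; exists g.
have n_gt1 : (1 < n)%N.
  rewrite ltnNge -szf; apply/negP => /size1_polyC fE.
  by move: Mf f_neq0; rewrite fE => /M_const ->; rewrite eqxx.
have /closed_nonrootP[al al_l] : lead_coef f != 0 by rewrite lead_coef_eq0.
have [g Mg] : exists g, g * ('X - al%:P)%:P - 1 \in M.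
  by apply: M_inv; apply/negP => /M_const /eqP; rewrite polyXsubC_eq0.
set u := g * _ - 1 in Mg.
have := Pdiv.Idomain.divp_eq u f; set k := scalp u f; set h := u %/ f => divE.
have modf0 : u %% f = 0.
  apply: minf; last by rewrite -szf ltn_modp.
  have -> : u %% f = lead_coef f ^+ k *: u - h * f by rewrite divE addrC addKr.
  by rewrite -mul_polyC ideal_subr // ideal_mull.
pose ev : {rmorphism {poly {poly F}} -> {poly F}} := map_poly (horner_eval al).
have szev : size (ev f) = n.
  by rewrite size_map_poly_id0 //; apply: contraNneq al_l; rewrite /root => ->.
have : ev (lead_coef f ^+ k *: u) = ev h * ev f by rewrite divE modf0 addr0 rmorphM.
rewrite -mul_polyC rmorphM rmorphB rmorphM rmorph1 /= !map_polyC /= !/(horner_eval _ _).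
rewrite hornerXsubC subrr mulr0 sub0r => /(congr1 (fun p : {poly F} => size p)).
have lk0 : (lead_coef f ^+ k).[al] != 0.
  by rewrite -/(horner_eval al _) rmorphXn expf_neq0.
rewrite mulrN1 size_polyN size_polyC lk0 -/(ev h) -/(ev f).
have [->|evh0] := eqVneq (ev h) 0; first by rewrite mul0r size_poly0.
rewrite size_mul // -?size_poly_gt0 szev; last by lia.
by move: evh0; rewrite -size_poly_gt0; move: (size (ev h)) => l; lia.
Qed.

(** Once s - al lies in M, every element is congruent to a polynomial in t alone. If t is not in M,
    a relation g t - 1 in M becomes a polynomial in t with constant term -1, hence nonzero, and it
    splits. Maximality is phrased by inverses modulo M, which is what [maximal_point] can transfer
    from Lambda. *)
Lemma bipoly_nullstellensatz (F : closedFieldType) (M : {pred {poly {poly F}}}) :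
  prime_ideal M ->
  (forall p, p \notin M -> exists g, g * p - 1 \in M) ->
  exists al be, ('X - al%:P)%:P \in M /\ 'X - be%:P%:P \in M.
Proof.
move=> M_prime M_inv; have M_id := M_prime.1.
have [p p0 Mp] := bipoly_meet_const M_prime M_inv.
pose C : {rmorphism {poly F} -> {poly {poly F}}} := polyC.
have [al Mal] := @prime_split_poly _ _ C _ _ M_prime p0 Mp; exists al.
have [Mt|/M_inv[g Mg]] := boolP ('X \in M).
  by exists 0; rewrite !polyC0 subr0.
pose ev : {rmorphism {poly {poly F}} -> {poly F}} := map_poly (horner_eval al).
have Mev (q : {poly {poly F}}) : q - map_poly polyC (ev q) \in M.
  elim/poly_ind: q => [|q c IHq]; first by rewrite /ev !rmorph0 subrr; case: M_id.
  have [c' cE] : exists c', c - c.[al]%:P = c' * ('X - al%:P).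
    apply/factor_theorem; rewrite /root !hornerE subrr //.
  have -> : q * 'X + c%:P - map_poly polyC (ev (q * 'X + c%:P)) =
     'X * (q - map_poly polyC (ev q)) + c'%:P * ('X - al%:P)%:P.
    rewrite -polyCM -cE polyCB /ev !(rmorphD, rmorphM) /= !(map_polyX, map_polyC) /=.
    by rewrite /horner_eval; ring.
  by rewrite ideal_addr // ideal_mull.
have := ideal_subr M_id Mg (Mev (g * 'X - 1)).
rewrite opprB addrC subrK.
pose mC : {rmorphism {poly F} -> {poly {poly F}}} := map_poly polyC.
move=> /(@prime_split_poly _ _ mC _ _ M_prime) [].
  apply/eqP => /(congr1 (fun p : {poly F} => p`_0)).
  rewrite /ev rmorphB rmorphM rmorph1 /= map_polyX coefB coefMX coef1 coef0 sub0r.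
  by move/eqP; rewrite oppr_eq0 oner_eq0.
move=> be Mbe; exists be; split; first exact: Mal.
by have <- : mC ('X - be%:P) = 'X - be%:P%:P by rewrite rmorphB /= map_polyX map_polyC.
Qed.

(** * Structure of Lambda *)

Local Notation y := ('X_(0 : 'I_2)).
Local Notation z := ('X_(1 : 'I_2)).

Lemma mpolyX2 (F : fieldType) (m : 'X_{1..2}) :
  'X_[m] = y ^+ m 0 * z ^+ m 1 :> {mpoly F[2]}.
Proof.
rewrite mpolyXE_id big_ord_recl big_ord1.
by rewrite (_ : lift ord0 ord0 = 1) //; apply: val_inj.
Qed.

Lemma mpoly2_ind (F : fieldType) (P : {mpoly F[2]} -> Prop) :
  (forall c, P c%:MP) -> (forall p q, P p -> P q -> P (p + q)) ->
  (forall p, P p -> P (p * y)) -> (forall p, P p -> P (p * z)) -> forall p, P p.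
Proof.
move=> PC PD Py Pz; elim/mpolyind => [|c m p _ _ Pp]; first by rewrite -mpolyC0.
apply: PD => //; rewrite -mul_mpolyC mpolyX2 mulrA.
elim: (m 1) => [|k IHk]; last by rewrite exprSr mulrA; apply: Pz.
rewrite mulr1; elim: (m 0) => [|k IHk]; first by rewrite mulr1.
by rewrite exprSr mulrA; apply: Py.
Qed.

Section LambdaRing.
Variables (F : fieldType) (a : nat -> F).

Lemma QE k : Q a k = (a k)%:MP * y ^+ k + z ^+ k.
Proof. by rewrite mul_mpolyC. Qed.

Lemma Q_Lambda k : (0 < k)%N -> Q a k \in Lambda a.
Proof. by move=> k_gt0; apply/asboolP => S _; apply. Qed.

Lemma mpolyC_Lambda c : c%:MP \in Lambda a.
Proof.
have [L1 LZD _] := Lambda_subalg a; have L0 : 0 \in Lambda a by exact: rpred0.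
by have := LZD c 1 0 L1 L0; rewrite addr0 -mul_mpolyC mulr1.
Qed.

Lemma Lambda_ind (P : {mpoly F[2]} -> Prop) :
  (forall c, P c%:MP) -> (forall p q, P p -> P q -> P (p + q)) ->
  (forall p q, P p -> P q -> P (p * q)) ->
  (forall k, (0 < k)%N -> P (Q a k)) -> forall p, p \in Lambda a -> P p.
Proof.
move=> PC PD PM PQ p /asboolP/(_ (fun p => `[< P p >])) pP; apply/asboolP.
apply: pP => [|k k_gt0]; last by apply/asboolP; apply: PQ.
split; first by apply/asboolP; rewrite -mpolyC1.
  move=> c u v /asboolP Pu /asboolP Pv; apply/asboolP.
  by rewrite -mul_mpolyC; apply: PD => //; apply: PM.
by move=> u v /asboolP Pu /asboolP Pv; apply/asboolP; apply: PM.
Qed.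

Definition lam_const (c : F) : Lambda_ring a := LambdaRing (mpolyC_Lambda c).

Fact lam_const_is_additive : additive lam_const.
Proof. by move=> c d; apply: val_inj; rewrite /= raddfB. Qed.

Fact lam_const_is_multiplicative : multiplicative lam_const.
Proof. by split=> [c d|]; apply: val_inj; rewrite /= ?rmorphM. Qed.

HB.instance Definition _ :=
  GRing.isAdditive.Build F (Lambda_ring a) lam_const lam_const_is_additive.
HB.instance Definition _ :=
  GRing.isMultiplicative.Build F (Lambda_ring a) lam_const
    lam_const_is_multiplicative.

(** The index is shifted: [lam_Q k] is Q_(k+1), which spares a positivity proof. *)
Definition lam_Q k : Lambda_ring a := LambdaRing (Q_Lambda (ltn0Sn k)).

(** The inner variable goes to Q_1 and the outer one to Q_2; the image is P. *)
Definition lam_poly : {poly {poly F}} -> Lambda_ring a :=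
  peval (peval lam_const (lam_Q 0)) (lam_Q 1).

HB.instance Definition _ := GRing.RMorphism.on lam_poly.

Definition phi (p : {poly {poly F}}) : {mpoly F[2]} := val (lam_poly p).

HB.instance Definition _ :=
  GRing.RMorphism.copy phi (val \o lam_poly).

Lemma lam_polyX : lam_poly 'X = lam_Q 1.
Proof. by rewrite /lam_poly pevalX. Qed.

Lemma lam_polyXC : lam_poly 'X%:P = lam_Q 0.
Proof. by rewrite /lam_poly pevalC /= pevalX. Qed.

Lemma lam_polyCC c : lam_poly c%:P%:P = lam_const c.
Proof. by rewrite /lam_poly pevalC /= pevalC. Qed.

Lemma lam_polyB : {morph lam_poly : p q / p - q}. Proof. exact: rmorphB. Qed.

Lemma phiX : phi 'X = Q a 2. Proof. by rewrite /phi lam_polyX. Qed.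

Lemma phiXC : phi 'X%:P = Q a 1. Proof. by rewrite /phi lam_polyXC. Qed.

Lemma phiCC c : phi c%:P%:P = c%:MP. Proof. by rewrite /phi lam_polyCC. Qed.

Lemma phiD : {morph phi : p q / p + q}. Proof. exact: rmorphD. Qed.
Lemma phiN : {morph phi : p / - p}. Proof. exact: rmorphN. Qed.
Lemma phiM : {morph phi : p q / p * q}. Proof. exact: rmorphM. Qed.
Lemma phiXn k : {morph phi : p / p ^+ k}. Proof. exact: rmorphXn. Qed.

Lemma phi_nat k : phi k%:R = k%:R. Proof. exact: rmorph_nat. Qed.

Definition phiE := (phiX, phiXC, phiCC, phi_nat, phiD, phiN, phiM, phiXn).

Lemma phi_Lambda p : phi p \in Lambda a.
Proof. exact: valP. Qed.

End LambdaRing.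

Arguments phi : simpl never.
Arguments lam_poly : simpl never.

(** * C[y,z] as a quadratic extension of P *)

Section QuadraticExtension.
Variables (F : fieldType) (a : nat -> F).
Hypothesis delta0 : a 2 + a 1 ^+ 2 != 0.
Let d := (a 2 + a 1 ^+ 2)^-1.

Let dE : d%:MP * ((a 2)%:MP + (a 1)%:MP ^+ 2) = 1 :> {mpoly F[2]}.
Proof. by rewrite -rmorphXn -rmorphD -rmorphM mulVf ?rmorph1. Qed.

(** Put z = Q_1 - a_1 y into Q_2 and solve for y^2, whose coefficient is a_2 + a_1^2. *)
Lemma y_quadratic : y ^+ 2 =
  d%:MP * (Q a 2 - Q a 1 ^+ 2) + 2%:R * d%:MP * (a 1)%:MP * Q a 1 * y :> {mpoly F[2]}.
Proof.
rewrite !QE !expr1; move: dE; set D := d%:MP; set A1 := (a 1)%:MP.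
set A2 := (a 2)%:MP; set Y := y; set Z := z => DE.
transitivity (D * (A2 + A1 ^+ 2) * Y ^+ 2); last by ring.
by rewrite DE mul1r.
Qed.

Lemma phi_basis (f : {mpoly F[2]}) : exists A B, f = phi a A + phi a B * y.
Proof.
have phi_y g : (exists A B, g = phi a A + phi a B * y) ->
    exists A B, g * y = phi a A + phi a B * y.
  move=> [A [B ->]].
  exists (B * (d%:P%:P * ('X - 'X%:P ^+ 2))).
  exists (A + B * (2%:R * d%:P%:P * (a 1)%:P%:P * 'X%:P)).
  rewrite [in LHS]mulrDl -mulrA -expr2 y_quadratic.
  by rewrite !phiE; ring.
elim/mpoly2_ind: f => [c|p q [A [B ->]] [C [D ->]]|p /phi_y //|p pE].
- by exists c%:P%:P, 0%:P%:P; rewrite !phiE mpolyC0 mul0r addr0.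
- by exists (A + C), (B + D); rewrite !phiE; ring.
have [C [D pyE]] := phi_y p pE; have [A [B pE']] := pE.
have -> : p * z = p * Q a 1 - (a 1)%:MP * (p * y) by rewrite QE !expr1; ring.
exists (A * 'X%:P - (a 1)%:P%:P * C), (B * 'X%:P - (a 1)%:P%:P * D).
by rewrite pyE {1}pE' !phiE; ring.
Qed.


(** Put z = Q_1 - a_1 y and reduce powers of y by [y_quadratic]. The coefficient of y, of the form b
    Q_2 + k Q_1^2, is explicit because [kerL_form] divides by it. *)
Lemma Q3E : exists A, Q a 3 = phi a A
   + phi a ((d * (a 3 - a 1 ^+ 3))%:P%:P * 'X
      + ((a 3 - a 1 ^+ 3) * (d ^+ 2 * a 1 ^+ 2 *+ 4 - d) + d * a 1 ^+ 3 *+ 6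
         - a 1 *+ 3)%:P%:P * 'X%:P ^+ 2) * y.
Proof.
exists (2%:R * (d ^+ 2 * a 1 * (a 3 - a 1 ^+ 3))%:P%:P * 'X%:P * ('X - 'X%:P ^+ 2)
     + 3%:R * (a 1 ^+ 2 * d)%:P%:P * 'X%:P * ('X - 'X%:P ^+ 2) + 'X%:P ^+ 3).
rewrite !phiE; have yq := y_quadratic.
rewrite !(mpolyCD, mpolyCB, mpolyCM, mpolyCMn, rmorphXn) /=.
set D := d%:MP in yq *; set A1 := (a 1)%:MP in yq *; set A3 := (a 3)%:MP.
set S := Q a 1 in yq *; set T := Q a 2 in yq *; set Y := y in yq *.
have -> : Q a 3 = A3 * Y ^+ 3 + (S - A1 * Y) ^+ 3.
  by rewrite /S !QE expr1 -/A1 -/A3 -/Y; ring.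
have -> : A3 * Y ^+ 3 + (S - A1 * Y) ^+ 3 = (A3 - A1 ^+ 3) * Y * Y ^+ 2
    + 3%:R * A1 ^+ 2 * S * Y ^+ 2 - 3%:R * A1 * S ^+ 2 * Y + S ^+ 3 by ring.
rewrite yq.
have -> : (A3 - A1 ^+ 3) * Y * (D * (T - S ^+ 2) + 2%:R * D * A1 * S * Y) =
  (A3 - A1 ^+ 3) * (D * (T - S ^+ 2) * Y + 2%:R * D * A1 * S * Y ^+ 2) by ring.
rewrite yq; ring.
Qed.

End QuadraticExtension.

(** * Kernels of twisted derivations *)

Section TwistedDerivation.
Variables (F : numClosedFieldType) (a : nat -> F).
Variables (e1 e2 : {rmorphism {mpoly F[2]} -> {poly F}}).
Variable L : {linear {mpoly F[2]} -> {poly F}}.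
Variables lam mu nu : F.
Hypothesis e1C : forall c, e1 c%:MP = c%:P.
Hypothesis e1Q1 : e1 (Q a 1) = mu *: 'X.
Hypothesis e1Q2 : e1 (Q a 2) = nu *: 'X^2.
Hypothesis LM : forall p q, L (p * q) = e1 p * L q + L p * e2 q.
Hypothesis Ly : L y = lam *: 'X.
Hypothesis LQ : forall k, (0 < k <= 3)%N -> L (Q a k) = 0.
Hypotheses (lam0 : lam != 0) (mu0 : mu != 0).
Hypotheses (a10 : a 1 != 0) (delta0 : a 2 + a 1 ^+ 2 != 0)
  (a1sq : a 1 ^+ 2 != a 2).

Lemma LC c : L c%:MP = 0.
Proof.
rewrite -[c%:MP]mulr1 mul_mpolyC linearZ /=.
have := LM 1 1; rewrite mulr1 !rmorph1 mulr1 mul1r => /eqP.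
by rewrite -subr_eq0 opprD addNKr oppr_eq0 => /eqP->; rewrite scaler0.
Qed.

Lemma LM0 p q : L p = 0 -> L (p * q) = e1 p * L q.
Proof. by move=> Lp0; rewrite LM Lp0 mul0r addr0. Qed.

Lemma Lphi p : L (phi a p) = 0.
Proof.
elim/poly_ind: p => [|p c IHp]; first by rewrite rmorph0 linear0.
rewrite !phiE linearD /= LM0 // LQ // mulr0 add0r.
elim/poly_ind: c => [|c k IHc]; first by rewrite polyC0 rmorph0 linear0.
by rewrite polyCD polyCM !phiE linearD /= LM0 // LQ // LC mulr0 addr0.
Qed.

Lemma e1phiC p : e1 (phi a p%:P) = p \Po (mu *: 'X).
Proof.
elim/poly_ind: p => [|p c IHp]; first by rewrite polyC0 !rmorph0.
by rewrite polyCD polyCM !phiE rmorphD rmorphM /= IHp e1C e1Q1 comp_polyD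
  comp_polyM comp_polyX comp_polyC.
Qed.

(** Write f = A + B y; since L kills P, L f = 0 means e1 B = 0. The same argument for Q_3 shows that
    e1 kills its y-coefficient b Q_2 + k Q_1^2. This element generates the kernel of e1 on P, so B
    is a multiple of it and B y is, modulo P, a multiple of Q_3. *)
Lemma kerL_form f : L f = 0 -> exists A C, f = phi a A + phi a C * Q a 3.
Proof.
have [A [B ->]] := phi_basis delta0 f; rewrite linearD /= Lphi add0r LM0 ?Lphi // Ly.
have [A3 Q3] := Q3E delta0; set d := (_ + _)^-1 in Q3.
set b := d * _ in Q3; set k := _ - _ *+ 3 in Q3.
have bk : b * nu + k * mu ^+ 2 = 0.
  have := LQ (k := 3) isT; rewrite Q3 linearD /= Lphi add0r LM0 ?Lphi // Ly.
  rewrite !phiE (rmorphD e1) !(rmorphM e1) -expr2 !e1C e1Q1 e1Q2.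
  have -> : b%:P * (nu *: 'X^2) + k%:P * (mu *: 'X) ^+ 2 = (b * nu + k * mu ^+ 2) *: 'X^2.
    by rewrite exprZn !mul_polyC !scalerA scalerDl.
  move/eqP; rewrite -scalerAl -scalerAr scalerA -exprSr scaler_eq0.
  by rewrite mulf_eq0 (negPf lam0) expf_eq0 polyX_eq0 !orbF => /eqP.
have dd : d * (a 2 + a 1 ^+ 2) = 1 by rewrite mulVf.
(* If b = 0, then a_3 = a_1^3 and k = 3 a_1 d (a_1^2 - a_2) is nonzero, against k mu^2 = 0. *)
have b0 : b != 0.
  apply/eqP => b0; move: bk; rewrite b0 mul0r add0r => /eqP.
  have a3 : a 3 - a 1 ^+ 3 = 0.
    by rewrite -[LHS]mul1r -dd mulrC mulrA (mulrC _ d) -/b b0 mul0r.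
  have -> : k = 3%:R * a 1 * d * (a 1 ^+ 2 - a 2).
    transitivity (d * a 1 ^+ 3 *+ 6 - a 1 * (d * (a 2 + a 1 ^+ 2)) *+ 3); last by ring.
    by rewrite /k a3 dd mul0r add0r mulr1.
  by apply/negP; rewrite !mulf_neq0 ?expf_neq0 ?invr_eq0 ?subr_eq0 ?pnatr_eq0.
move=> /eqP; rewrite mulf_eq0 scaler_eq0 (negPf lam0) polyX_eq0 !orbF => /eqP e1B.
pose c : {poly F} := - (k / b) *: 'X^2.
have e1c : e1 (phi a ('X - c%:P)) = 0.
  rewrite !phiE rmorphD rmorphN /= e1phiC e1Q2 comp_polyZ comp_Xn_poly exprZn.
  rewrite scalerA -scalerBl mulNr opprK.
  have -> : nu + k / b * mu ^+ 2 = (b * nu + k * mu ^+ 2) / b by field.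
  by rewrite bk mul0r scale0r.
have [C BE] : exists C, B - (B.[c])%:P = C * ('X - c%:P).
  by apply/factor_theorem; rewrite /root !hornerE subrr.
(* The remainder of B modulo Q_2 - c(Q_1) is a polynomial in Q_1 alone, on which e1 is the injective
   substitution of mu x. *)
have Bc0 : B.[c] = 0.
  have := e1B; rewrite -[in phi _ _](subrK (B.[c])%:P B) BE phiD rmorphD phiM rmorphM /= e1c.
  rewrite mulr0 add0r e1phiC => /(congr1 (fun p => p \Po (mu^-1 *: 'X))).
  rewrite -comp_polyA comp_polyZ comp_polyX scalerA mulfV // scale1r comp_polyXr.
  by rewrite comp_poly0.
have -> : phi a B * y = phi a C * (b^-1)%:MP * (Q a 3 - phi a A3).
  rewrite Q3 addrC addKr -[in LHS](subr0 B) -polyC0 -Bc0 BE phiM -!mulrA; congr (_ * _).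
  rewrite mulrA -(phiCC a) -phiM; congr (phi _ _ * _).
  rewrite mulrDr !mulrA -!polyCM mulVf // !polyC1 mul1r; congr (_ + _).
  by rewrite /c scaleNr polyCN opprK -mul_polyC expr2 mulrA (mulrC k).
exists (A - C * (b^-1)%:P%:P * A3), (C * (b^-1)%:P%:P).
by rewrite !phiE; ring.
Qed.

Lemma kerL_Lambda f : L f = 0 -> f \in Lambda a.
Proof.
by move=> /kerL_form[A [C ->]]; rewrite rpredD ?rpredM ?phi_Lambda ?Q_Lambda.
Qed.

End TwistedDerivation.

(** * The Cohen-Macaulay property *)

Section Curve.
Variables (F : fieldType) (u v : {poly F}).

Definition curve : {mpoly F[2]} -> {poly F} :=
  mmap polyC (fun k : 'I_2 => if k == 0 then u else v).

HB.instance Definition _ := GRing.RMorphism.on curve.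

Lemma curveC c : curve c%:MP = c%:P. Proof. exact: mmapC. Qed.

Lemma curve_y : curve y = u. Proof. by rewrite /curve mmapX mmap1U. Qed.

Lemma curve_z : curve z = v. Proof. by rewrite /curve mmapX mmap1U. Qed.

Lemma curveQ (a : nat -> F) k : curve (Q a k) = a k *: u ^+ k + v ^+ k.
Proof.
by rewrite QE rmorphD rmorphM !rmorphXn /= curveC curve_y curve_z mul_polyC.
Qed.

End Curve.

(** Let r restrict to the line and let i put y for the parameter. Then f - i (r f) is a multiple of
    the equation of the line for every f, by induction on f. *)
Lemma curve_kernel (F : fieldType) (b c : F) (f : {mpoly F[2]}) :
  curve 'X (c%:P - b *: 'X) f = 0 -> exists g, f = (b%:MP * y + z - c%:MP) * g.
Proof.
pose r : {rmorphism {mpoly F[2]} -> {poly F}} := curve 'X (c%:P - b *: 'X).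
pose i : {rmorphism {poly F} -> {mpoly F[2]}} := peval (@mpolyC 2 F) y.
have rC k : r k%:MP = k%:P by apply: curveC.
have ry : r y = 'X by apply: curve_y.
have rz : r z = c%:P - b *: 'X by apply: curve_z.
suff [g fg] : exists g, f - i (r f) = (b%:MP * y + z - c%:MP) * g.
  by move=> /= rf0; exists g; rewrite -fg /= rf0 rmorph0 subr0.
have iC k : i k%:P = k%:MP by apply: pevalC.
have iX : i 'X = y by apply: pevalX.
elim/mpoly2_ind: f => [k|p q [g pg] [h qh]|p [g pg]|p [g pg]].
- by exists 0; rewrite rC iC subrr mulr0.
- exists (g + h); rewrite (rmorphD r) rmorphD mulrDr -pg -qh; ring.
- by exists (g * y); rewrite (rmorphM r) rmorphM ry iX mulrA -pg; ring.
- exists (g * z + i (r p)); rewrite (rmorphM r) rmorphM rz mulrDr mulrA -pg.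
  by rewrite rmorphB /= -mul_polyC rmorphM !iC iX; ring.
Qed.

Lemma Lambda_lex_dep (F : fieldType) (a : nat -> F) (u v w : Lambda_ring a) :
  lex_dep u v w.
Proof.
have [p p0 up] := mpoly2_dep (val u) (val v) (val w).
apply: (poly3_lex_dep (f := lam_const a) p0); apply: val_inj.
rewrite -[RHS]up /=.
by do 3?apply: (peval_morph (g := (val : {rmorphism Lambda_ring a -> {mpoly F[2]}}))) => ?.
Qed.

Lemma noetherian_adjoin (A B : comNzRingType) (f : {rmorphism A -> B}) (x : B) :
  noetherian A -> (forall b, exists p q, b = f p + f q * x) -> noetherian B.
Proof.
move=> /hilbert_basis noethA fx; apply: (noetherian_surj (f := peval f x)) noethA.
move=> b; have [p [q ->]] := fx b; exists (q%:P * 'X + p%:P).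
by rewrite /= pevalMXD pevalC addrC.
Qed.

Section CohenMacaulay.
Variables (F : numClosedFieldType) (a : nat -> F).
Variables (e1 e2 : {rmorphism {mpoly F[2]} -> {poly F}}).
Variable L : {linear {mpoly F[2]} -> {poly F}}.
Variables lam mu nu : F.
Hypothesis e1C : forall c, e1 c%:MP = c%:P.
Hypothesis e1Q1 : e1 (Q a 1) = mu *: 'X.
Hypothesis e1Q2 : e1 (Q a 2) = nu *: 'X^2.
Hypothesis LM : forall p q, L (p * q) = e1 p * L q + L p * e2 q.
Hypothesis Ly : L y = lam *: 'X.
Hypothesis LQ : forall k, (0 < k)%N -> L (Q a k) = 0.
Hypotheses (lam0 : lam != 0) (mu0 : mu != 0).
Hypotheses (a10 : a 1 != 0) (delta0 : a 2 + a 1 ^+ 2 != 0)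
  (a1sq : a 1 ^+ 2 != a 2).

Let LQ3 k : (0 < k <= 3)%N -> L (Q a k) = 0.
Proof. by case/andP => /LQ. Qed.

Let kerL_L f : L f = 0 -> f \in Lambda a.
Proof. exact: kerL_Lambda e1C e1Q1 e1Q2 LM Ly LQ3 lam0 mu0 a10 delta0 a1sq f. Qed.

Lemma Lambda_kerL f : (f \in Lambda a) = (L f == 0).
Proof.
apply/idP/eqP => [|/kerL_L //]; elim/Lambda_ind => [c|p q Lp Lq|p q Lp Lq|k /LQ //].
- exact: LC LM c.
- by rewrite linearD /= Lp Lq addr0.
- by rewrite LM Lp Lq mulr0 mul0r addr0.
Qed.

Lemma Lambda_noetherian : noetherian (Lambda_ring a).
Proof.
pose P2 : comNzRingType := {poly {poly F}}.
pose f : {rmorphism P2 -> Lambda_ring a} := lam_poly a.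
apply: (@noetherian_adjoin P2 _ f (lam_Q a 2)) => [|g].
  by apply: hilbert_basis; apply: hilbert_basis; apply: field_noetherian.
have /eqP Lg : L (val g) == 0 by rewrite -Lambda_kerL; apply: valP.
have [A [C gE]] := kerL_form e1C e1Q1 e1Q2 LM Ly LQ3 lam0 mu0 a10 delta0 a1sq Lg.
by exists A, C; apply: val_inj; rewrite gE.
Qed.

(** Integrality over P: u is the trace of g in the quadratic extension and - v its norm. *)
Lemma Lambda_quadratic (g : Lambda_ring a) :
  exists u v, g ^+ 2 = lam_poly a u * g + lam_poly a v.
Proof.
have [A [B gE]] := phi_basis delta0 (val g).
have [A1 [B1 yE]] := phi_basis delta0 (y ^+ 2).
exists (2%:R * A + B * B1), (B ^+ 2 * A1 - A ^+ 2 - B * B1 * A); apply: val_inj.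
rewrite rmorphXn rmorphD rmorphM /= -!/(phi a _) !phiE gE.
transitivity (phi a A ^+ 2 + 2%:R * phi a A * phi a B * y + phi a B ^+ 2 * y ^+ 2).
  by ring.
by rewrite yE; ring.
Qed.

Lemma maximal_point (M : {pred Lambda_ring a}) : maximal_ideal M ->
  exists al be, lam_Q a 0 - lam_const a al \in M /\ lam_Q a 1 - lam_const a be \in M.
Proof.
move=> Mmax; have M_prime := maximal_ideal_prime Mmax; have M_id := M_prime.1.
pose m : {pred {poly {poly F}}} := fun p => lam_poly a p \in M.
have m_prime : prime_ideal m.
  split; first exact: preim_ideal M_id.
  by move=> u v; rewrite !unfold_in rmorphM; apply: M_prime.2.
have [|al [be [Mal Mbe]]] := bipoly_nullstellensatz m_prime.
  move=> p; rewrite unfold_in => /(maximal_ideal_inv Mmax)[g Mg].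
  (* Multiplying g^2 = u g + v by p^2 and using g p = 1 modulo M gives 1 = (u + v p) p modulo M, an
     inverse of p lying in P. *)
  have [u [v guv]] := Lambda_quadratic g; exists (u + v * p).
  pose f : {rmorphism {poly {poly F}} -> Lambda_ring a} := lam_poly a.
  rewrite unfold_in (rmorphB f) (rmorphM f) (rmorphD f) (rmorphM f) (rmorph1 f) /=.
  set P := lam_poly a p in Mg *; set U := lam_poly a u in guv *; set V := lam_poly a v in guv *.
  have -> : (U + V * P) * P - 1 = (g ^+ 2 * P ^+ 2 - 1) - U * P * (g * P - 1).
    by rewrite guv; ring.
  rewrite ideal_subr ?ideal_mull //.
  have -> : g ^+ 2 * P ^+ 2 - 1 = (g * P + 1) * (g * P - 1) by ring.
  by rewrite ideal_mull.
exists al, be; move: Mal Mbe; rewrite !unfold_in polyCB !lam_polyB.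
by rewrite lam_polyX lam_polyXC !lam_polyCC.
Qed.
Let line al : {rmorphism {mpoly F[2]} -> {poly F}} :=
  curve 'X (al%:P - a 1 *: 'X).

(** If f vanishes on the line Q_1 = al, then f = (Q_1 - al) g in C[y,z]. Applying L gives (mu x -
    al) L g = 0, so L g = 0 and g is itself in Lambda. *)
Lemma line_ideal al (f : Lambda_ring a) :
  line al (val f) = 0 <-> ideal_gen [:: lam_Q a 0 - lam_const a al] f.
Proof.
have sE : val (lam_Q a 0 - lam_const a al) = (a 1)%:MP * y + z - al%:MP.
  by rewrite rmorphB /= QE !expr1.
rewrite ideal_gen1P; split=> [/curve_kernel[g fE]|[c ->]]; last first.
  have ls : line al (val (lam_Q a 0 - lam_const a al)) = 0.
    rewrite sE -[_ * y + z]/(_ + z ^+ 1) -[y]/(y ^+ 1) -QE (rmorphB (line al)) /=.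
    by rewrite curveQ curveC !expr1 [X in X - _]addrC subrK subrr.
  have -> : val (c * (lam_Q a 0 - lam_const a al)) =
      val c * val (lam_Q a 0 - lam_const a al) by rewrite rmorphM.
  by rewrite (rmorphM (line al)) ls mulr0.
have Lg : L g = 0.
  have /eqP : L (val f) == 0 by rewrite -Lambda_kerL; apply: valP.
  have Ls : L ((a 1)%:MP * y + z - al%:MP) = 0.
    rewrite -sE; apply/eqP; rewrite -Lambda_kerL; exact: valP.
  rewrite fE (LM0 LM) // => /eqP; rewrite mulf_eq0 => /orP[|/eqP //].
  have -> : (a 1)%:MP * y + z = Q a 1 by rewrite QE !expr1.
  rewrite rmorphB /= e1Q1 e1C subr_eq0 => /eqP/(congr1 (fun p : {poly F} => p`_1)).
  by rewrite coefZ coefX coefC mulr1 => /eqP; rewrite (negPf mu0).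
exists (LambdaRing (kerL_L Lg)); apply: val_inj.
by rewrite fE mulrC -sE [RHS]rmorphM.
Qed.

Lemma line_Q2 al be : line al (val (lam_Q a 1 - lam_const a be)) != 0.
Proof.
have -> : val (lam_Q a 1 - lam_const a be) = Q a 2 - be%:MP by rewrite rmorphB.
rewrite (rmorphB (line al)) /= curveC curveQ.
apply/eqP => /(congr1 (fun p : {poly F} => p`_2)) /eqP.
have -> : a 2 *: 'X^2 + (al%:P - a 1 *: 'X) ^+ 2 - be%:P =
    (a 2 + a 1 ^+ 2)%:P * 'X^2 - (al * a 1 *+ 2)%:P * 'X + (al ^+ 2 - be)%:P.
  by rewrite -!mul_polyC !(polyCB, polyCD, polyC_exp, polyCMn, polyCM); ring.
rewrite !(coefD, coefN, coefCM, coefC, coefX, coefXn) /=.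
by rewrite mulr1 mulr0 subr0 addr0 (negPf delta0).
Qed.

Theorem Lambda_cohen_macaulay : cohen_macaulay (Lambda_ring a).
Proof.
split; first exact: Lambda_noetherian.
move=> M Mmax; have M_prime := maximal_ideal_prime Mmax; have M_id := M_prime.1.
have [al [be [Ms Mt]]] := maximal_point Mmax.
set s := lam_Q a 0 - _ in Ms; set t := lam_Q a 1 - _ in Mt.
have dep := @Lambda_lex_dep F a.
pose ev : {rmorphism Lambda_ring a -> {poly F}} := line al \o val.
have s0 : val s != 0.
  apply/eqP => s0; have : e1 (val s) = 0 by rewrite s0 rmorph0.
  have -> : val s = Q a 1 - al%:MP by rewrite rmorphB.
  rewrite (rmorphB e1) /= e1Q1 e1C => /(congr1 (fun p : {poly F} => p`_1)).
  by rewrite coefB coefZ coefX coefC coef0 mulr1 subr0; apply/eqP.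
have stM : {subset [:: s; t] <= M} by move=> x; rewrite !inE => /orP[/eqP->|/eqP->].
exists 2%N; split; split.
- exists [:: s; t]; split=> //; split.
    by move/(ideal_sub M_id stM); apply/negP; case: M_id.
  move=> [|[|//]] _ x /=.
    rewrite !ideal_gen_nil => /(congr1 val); rewrite rmorphM rmorph0 => /eqP.
    by rewrite mulf_eq0 (negPf s0) => /eqP x0; apply: val_inj.
  rewrite -!line_ideal; have -> : val (t * x) = val t * val x by rewrite rmorphM.
  rewrite (rmorphM (line al)) => /eqP.
  by rewrite mulf_eq0 (negPf (line_Q2 _ _)) => /eqP.
- by move=> u u_reg _; apply: lex_dep_regular u_reg.
(* The chain is 0, the elements vanishing on the line, M; s separates the first two and t the last
   two. *)
- exists (fun k => if k is k'.+1 then if k' is _.+1 then M else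
            (fun x => ev x == 0) else fun x => val x == 0); split=> //.
    move=> [|[|[|//]]] _; [exact: ker_prime | exact: ker_prime | exact: M_prime].
  move=> [|[|//]] _; split.
  + by move=> x; rewrite !unfold_in => /eqP x0; rewrite /ev /= x0 rmorph0.
  + move/(_ s); rewrite !unfold_in => s_in; move: s0; rewrite s_in //.
    by apply/eqP/line_ideal/ideal_gen_mem; rewrite mem_head.
  + move=> x; rewrite unfold_in => /eqP/line_ideal; apply: ideal_sub => //.
    by move=> w; rewrite inE => /eqP->.
  + by move/(_ t Mt); rewrite unfold_in; apply/negP; apply: line_Q2.
- by move=> n p; apply: lex_dep_prime_chain.
Qed.

End CohenMacaulay.

(** * The Hilbert series *)

Lemma mpolyXU_exp_homog (F : fieldType) n (i : 'I_n) k :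
  'X_i ^+ k \is [in F[n], k.-homog].
Proof. by rewrite mpolyXn dhomogX /= mdegMn mdeg1 mul1n. Qed.

Lemma Q_homog (F : fieldType) (a : nat -> F) k : Q a k \is k.-homog.
Proof. by rewrite rpredD ?rpredZ ?mpolyXU_exp_homog. Qed.

Lemma curve_line_homog (F : fieldType) (b c : F) d (p : {mpoly F[2]}) : p \is d.-homog ->
  exists k, curve (b *: 'X) (c *: 'X) p = k *: 'X^d.
Proof.
move=> p_hom; rewrite (mpolyE p) rmorph_sum /= big_seq.
elim/big_rec: _ => [|m q mp [k ->]]; first by exists 0; rewrite scale0r.
have <- : mdeg m = d by have /dhomogP := p_hom; apply.
exists (p@_m * (b ^+ m 0 * c ^+ m 1) + k).
rewrite -mul_mpolyC mpolyX2 !rmorphM !rmorphXn /= curveC curve_y curve_z.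
have -> : mdeg m = addn (m 0) (m 1).
  by rewrite mdegE big_ord_recl big_ord1 (_ : lift ord0 ord0 = 1) //; apply: val_inj.
by rewrite !exprZn -!mul_polyC polyCD !polyCM exprD; ring.
Qed.

(** The denominator is 1 - u - u^2 + u^3, whose recurrence annihilates the sequence d. The
    exceptional value 1 at d = 0 enters only for n < 4, checked case by case. *)
Lemma h_series : series_eq_frac (fun d => if d is 0 then 1%N else d) h_num h_den.
Proof.
set H := fun d => _.
have denE : h_den = 1 - 'X - 'X^2 + 'X^3 by rewrite /h_den; ring.
have den_i k : h_den`_k = (k == 0)%:R - (k == 1)%:R - (k == 2)%:R + (k == 3)%:R.
  by rewrite denE !(coefD, coefN, coef1, coefX, coefXn).
move=> n; rewrite /h_num coefD coef1 coefXn.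
have [ltn4|le4n] := ltnP n 4.
  by case: n ltn4 => [|[|[|[|//]]]] _; rewrite !big_ord_recr big_ord0 /= !den_i.
rewrite -(big_mkord xpredT (fun k => h_den`_k * (H (n - k)%N)%:Z)).
rewrite (big_cat_nat _ (n := 4)) //=; last by lia.
rewrite [X in _ + X]big_nat_cond [X in _ + X]big1 => [|k]; last first.
  rewrite andbT => /andP[le4k _]; rewrite den_i.
  by case: k le4k => [|[|[|[|k]]]] //= _; rewrite mul0r.
rewrite !big_nat_recr //= big_geq // !den_i /=.
case: n le4n => [|[|[|[|n]]]] // _; rewrite !subSS !subn0 /H /=; lia.
Qed.

Section HilbertSeries.
Variables (F : numClosedFieldType) (a : nat -> F).
Variables (e1 e2 : {rmorphism {mpoly F[2]} -> {poly F}}).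
Variable L : {linear {mpoly F[2]} -> {poly F}}.
Variables lam mu : F.
Hypothesis e1Q1 : e1 (Q a 1) = mu *: 'X.
Hypothesis LM : forall p q, L (p * q) = e1 p * L q + L p * e2 q.
Hypothesis Ly : L y = lam *: 'X.
Hypotheses (lam0 : lam != 0) (mu0 : mu != 0).
Hypothesis Lhom : forall d p, p \is d.-homog -> exists k, L p = k *: 'X^d.
Hypothesis LambdaE : forall f, (f \in Lambda a) = (L f == 0).

(** In degree d, Lambda is the kernel of the functional taking f to the coefficient of x^d in L f.
    This functional is zero for d = 0; for d > 0 it is nonzero on Q_1^(d-1) y. *)
Theorem Lambda_hilbert_series : hilbert_series_eq a h_num h_den.
Proof.
exists (fun d => if d is 0 then 1%N else d); split; last exact: h_series.
move=> d; pose f : {linear dhomog 2 F d -> F^o} := coefp d \o (L \o @mpoly_of_dhomog 2 F d).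
exists (lker (linfun f)); split.
  move=> p; rewrite memv_ker lfunE /= LambdaE.
  have [k ->] := Lhom (dhomog_is_dhomog p).
  by rewrite coefZ coefXn eqxx mulr1 scaler_eq0 expf_eq0 polyX_eq0 andbF orbF.
have := limg_ker_dim (linfun f) fullv; rewrite capfv dimvf.
have -> : dim (dhomog 2 F d) = d.+1 by rewrite /dim /= addn1 binSn.
have fE p : linfun f p = (L (mpoly_of_dhomog p))`_d by rewrite lfunE.
case: d @f fE => [|d] f fE.
  have -> : limg (linfun f) = 0%VS.
    apply/eqP; rewrite -subv0; apply/subvP => _ /memv_imgP[p _ ->]; rewrite fE.
    have /msize1_polyC -> : (msize (mpoly_of_dhomog p) <= 1)%N.
      rewrite msizeE big_seq; apply/bigmax_leqP_seq => m mp _.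
      by have /dhomogP/(_ m mp) /= -> := dhomog_is_dhomog p.
    by rewrite (LC LM) coef0 mem0v.
  by rewrite dimv0 addn0.
have f_neq0 : (0 < \dim (limg (linfun f)))%N.
  rewrite lt0n dimv_eq0.
  have p_hom : Q a 1 ^+ d * y \is [in F[2], (S d).-homog].
    have := dhomogM (dhomogMn d (Q_homog a 1)) (mpolyXU_exp_homog F 0 1).
    by rewrite mul1n addn1.
  apply/eqP => f0; have := memv_img (linfun f) (memvf (DHomog p_hom)); rewrite f0 memv0 fE /=.
  have LQ1d : L (Q a 1 ^+ d) = 0 by apply/eqP; rewrite -LambdaE rpredX // Q_Lambda.
  rewrite (LM0 LM) // Ly rmorphXn /= e1Q1 exprZn -scalerAl -scalerAr scalerA -exprSr.
  by rewrite coefZ coefXn eqxx mulr1 mulf_eq0 expf_eq0 (negPf mu0) (negPf lam0) andbF.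
have : (\dim (limg (linfun f)) <= 1)%N.
  by rewrite (leq_trans (dimvS (subvf _))) // dimvf.
by move: (\dim _) (\dim _) f_neq0 => m n; lia.
Qed.
End HilbertSeries.

(** * Failure of the Cohen-Macaulay property *)

Lemma Lambda_mul_forms (F : fieldType) (a : nat -> F) d (f g : {mpoly F[2]}) :
  f \is d.-homog -> (forall k p, (d < k)%N -> p \is k.-homog -> p \in Lambda a) ->
  g@_0 = 0 -> f * g \in Lambda a.
Proof.
move=> f_hom big_forms g0; rewrite [g]mpolyE mulr_sumr rpred_sum // => m _.
have [->|m0] := eqVneq m 0%MM; first by rewrite g0 scale0r mulr0 rpred0.
rewrite -mul_mpolyC mulrCA rpredM ?mpolyC_Lambda //.
apply: (big_forms (d + mdeg m)%N); last by rewrite dhomogM ?dhomogX.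
by rewrite -[X in (X < _)%N]addn0 ltn_add2l lt0n mdeg_eq0.
Qed.

Lemma mcoeff0M (F : fieldType) n (p q : {mpoly F[n]}) : (p * q)@_0 = p@_0 * q@_0.
Proof. exact: (rmorphM (mcoeff 0)). Qed.

Lemma mcoeff0U (F : fieldType) n (k : 'I_n) : ('X_k : {mpoly F[n]})@_0 = 0.
Proof.
by rewrite mcoeffX; case: eqP => // /(congr1 (@mdeg n)); rewrite mdeg1 mdeg0.
Qed.

Lemma mderivU (F : fieldType) n (j k : 'I_n) :
  ('X_j : {mpoly F[n]})^`M(k) = (j == k)%:R.
Proof.
rewrite mderivX mnm1E; case: eqVneq => [->|_]; last by rewrite scale0r.
rewrite (_ : (U_(k) - U_(k))%MM = 0%MM) ?mpolyX0 ?scale1r //.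
by apply/mnmP => l; rewrite mnmBE mnm0E subnn.
Qed.

(** [T] is the derivative at the origin in the direction (1, - a_1). It kills Q_1 and all higher
    Q_k, hence Lambda, but takes y to 1. *)
Lemma y_notin_Lambda (F : fieldType) (a : nat -> F) : y \notin Lambda a.
Proof.
pose T (p : {mpoly F[2]}) : F := (p^`M(0))@_0 - a 1 * (p^`M(1))@_0.
have TM p q : T (p * q) = p@_0 * T q + T p * q@_0.
  by rewrite /T !mderivM !mcoeffD !mcoeff0M; ring.
have TD p q : T (p + q) = T p + T q by rewrite /T !mderivD !mcoeffD; ring.
have TC c : T c%:MP = 0 by rewrite /T !mderivC mcoeff0 mulr0 subr0.
have Ty : T y = 1 by rewrite /T !mderivU /= mcoeff1 mcoeff0 mulr0 subr0 eqxx.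
have Tz : T z = - a 1 by rewrite /T !mderivU /= mcoeff1 mcoeff0 sub0r eqxx mulr1.
have TX2 j k : T ('X_j ^+ k.+2) = 0.
  by rewrite exprS TM mcoeff0U mul0r exprS mcoeff0M mcoeff0U mul0r mulr0 addr0.
have TL p : p \in Lambda a -> T p = 0.
  elim/Lambda_ind => [//|u v Tu Tv|u v Tu Tv|[//|[|k]] _].
  - by rewrite TD Tu Tv addr0.
  - by rewrite TM Tu Tv mulr0 mul0r addr0.
  - by rewrite QE !expr1 TD TM TC mul0r addr0 mcoeffC eqxx mulr1 Ty Tz mulr1 subrr.
  - by rewrite QE TD TM TC !TX2 mulr0 mul0r !addr0.
by apply/negP => /TL; rewrite Ty => /eqP; rewrite oner_eq0.
Qed.

Lemma curve_coef0 (F : fieldType) (u v : {poly F}) (p : {mpoly F[2]}) :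
  u.[0] = 0 -> v.[0] = 0 -> (curve u v p).[0] = p@_0.
Proof.
move=> u0 v0.
elim/mpoly2_ind: p => [c|p q IHp IHq|p _|p _].
- by rewrite curveC hornerC mcoeffC eqxx mulr1.
- by rewrite rmorphD hornerD IHp IHq mcoeffD.
- rewrite rmorphM /= curve_y hornerM u0 mulr0.
  by rewrite mcoeff0M mcoeff0U mulr0.
- rewrite rmorphM /= curve_z hornerM v0 mulr0.
  by rewrite mcoeff0M mcoeff0U mulr0.
Qed.

Lemma maximal_mcoeff0 (F : fieldType) (a : nat -> F) :
  maximal_ideal (fun g : Lambda_ring a => (val g)@_0 == 0).
Proof.
pose c0 : {rmorphism Lambda_ring a -> F} := mcoeff 0 \o val.
split=> [|I I_id MI g Ig]; first by have [] := ker_prime c0.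
rewrite unfold_in; apply: contraT => g0; have [_ /negP I1 _] := I_id; case: I1.
have -> : 1 = lam_const a ((val g)@_0)^-1 * (g - (g - lam_const a (val g)@_0)).
  by rewrite opprB addrC subrK -rmorphM mulVf // rmorph1.
apply: ideal_mull => //; apply: ideal_subr => //; apply: MI; rewrite unfold_in.
have -> : val (g - lam_const a (val g)@_0) = val g - ((val g)@_0)%:MP.
  by rewrite rmorphB.
by rewrite mcoeffB mcoeffC eqxx mulr1 subrr.
Qed.

Section Converse.
Variables (F : fieldType) (a : nat -> F) (n : nat).
Hypothesis (a10 : a 1 != 0).
Hypothesis n_forms : forall k p, (n <= k)%N -> p \is k.-homog -> p \in Lambda a.

Lemma extremal_form : exists d f, [/\ f \is d.-homog, f \notin Lambda a
  & forall k p, (d < k)%N -> p \is k.-homog -> p \in Lambda a].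
Proof.
pose S d := `[< exists f, f \is d.-homog /\ f \notin Lambda a >].
have S_le d : S d -> (d <= n)%N.
  move=> /asboolP[f [f_hom Nf]]; rewrite leqNgt; apply: contra Nf => ltnd.
  exact: n_forms (ltnW ltnd) f_hom.
have exS : exists d, S d.
  exists 1%N; apply/asboolP; exists y.
  by split; [exact: (mpolyXU_exp_homog F 0 1) | exact: y_notin_Lambda].
case: (ex_maxnP exS S_le) => d /asboolP[f [f_hom Nf]] maxd; exists d, f; split=> //.
move=> k p ltdk p_hom; apply: contraLR ltdk => Np; rewrite -leqNgt maxd //.
by apply/asboolP; exists p.
Qed.

Theorem Lambda_not_cohen_macaulay : ~ cohen_macaulay (Lambda_ring a).
Proof.
move=> [_ CM]; have [d [[[s [s_reg sM sd]] _] [_ le_d]]] := CM _ (maximal_mcoeff0 a).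
pose ev : {rmorphism Lambda_ring a -> {poly F}} := curve 'X 0 \o val.
have d_gt1 : (1 < d)%N.
  pose p k := if k is k'.+1 then if k' is _.+1 then
    (fun g : Lambda_ring a => (val g)@_0 == 0) else
    (fun x => ev x == 0) else fun x => val x == 0.
  apply: (le_d 2%N p); split=> //.
    move=> [|[|[|//]]] _; [exact: ker_prime | exact: ker_prime |].
    exact: maximal_ideal_prime (maximal_mcoeff0 a).
  move=> [|[|//]] _; split.
  - by move=> x; rewrite !unfold_in => /eqP x0; rewrite /ev /= x0 rmorph0.
  (* z y^n has degree above n, so it lies in Lambda; it is nonzero but vanishes on the line z =
     0. *)
  - have zy_hom : z * y ^+ n \is [in F[2], (S n).-homog].
      exact: dhomogM (mpolyXU_exp_homog F 1 1) (mpolyXU_exp_homog F 0 n).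
    move/(_ (LambdaRing (n_forms (leqnSn n) zy_hom))); rewrite !unfold_in /= rmorphM.
    rewrite /= curve_z mul0r eqxx.
    move/(_ isT); apply/negP.
    by rewrite mulf_neq0 ?expf_neq0 // -msupp_eq0 msuppX.
  - move=> x; rewrite !unfold_in => /eqP /(congr1 (fun p => p.[0])).
    by rewrite curve_coef0 ?hornerX ?horner0 // => ->.
  - move/(_ (lam_Q a 0)); rewrite !unfold_in /= curveQ !expr1.
    rewrite addr0 scaler_eq0 (negPf a10) polyX_eq0.
    rewrite QE !expr1 mcoeffD mcoeff0M !mcoeff0U mulr0 addr0 eqxx.
    by move/(_ isT).
case: s sd s_reg sM => [|u [|v s]] sd [_ reg] sM; rewrite -?sd // in d_gt1.
have [e [f [f_hom Nf f_top]]] := extremal_form.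
have f_mul (w : Lambda_ring a) : w \in [:: u, v & s] -> f * val w \in Lambda a.
  by move=> /sM; rewrite unfold_in => /eqP w0; exact: Lambda_mul_forms f_hom f_top w0.
have ufL := f_mul u (mem_head _ _).
have vfL : f * val v \in Lambda a by apply: f_mul; rewrite !inE eqxx orbT.
have u0 : u != 0.
  apply/eqP => u0; have /= := reg 0%N isT 1; rewrite !ideal_gen_nil u0 mul0r.
  by move/(_ erefl)/eqP; rewrite oner_eq0.
(* As v (f u) = (f v) u with f v in Lambda, regularity makes f u a multiple c u with c in Lambda;
   cancelling u gives f = c, a contradiction. *)
have /= := reg 1%N isT (LambdaRing ufL); rewrite !ideal_gen1P; case.
  by exists (LambdaRing vfL); apply: val_inj; rewrite !rmorphM /=; ring.
move=> c /(congr1 val); rewrite rmorphM /=; apply/eqP.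
have vu0 : val u != 0 by apply: contraNneq u0 => vu0; apply/eqP/val_inj.
rewrite (inj_eq (mulIf vu0)).
by apply: contraNneq Nf => ->; apply: valP.
Qed.

End Converse.

(** * The two families *)

Section LinePair.
Variables (F : numClosedFieldType) (b1 c1 b2 c2 lam lam' : F).
Let e1 : {rmorphism {mpoly F[2]} -> {poly F}} := curve (b1 *: 'X) (c1 *: 'X).
Let e2 : {rmorphism {mpoly F[2]} -> {poly F}} := curve (b2 *: 'X) (c2 *: 'X).
Variable L : {linear {mpoly F[2]} -> {poly F}}.
Hypothesis LM : forall p q, L (p * q) = e1 p * L q + L p * e2 q.
Hypotheses (Ly : L y = lam *: 'X) (Lz : L z = lam' *: 'X).

Lemma twisted_der_homog d p : p \is d.-homog -> exists k, L p = k *: 'X^d.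
Proof.
have LXM (v : 'I_2) (r : F) m (q : {mpoly F[2]}) : L 'X_v = r *: 'X -> q \is m.-homog ->
    (exists k, L q = k *: 'X^m) -> exists k, L ('X_v * q) = k *: 'X^(m.+1).
  move=> Lv q_hom [k Lq]; have [k1 e1v] := curve_line_homog b1 c1 (mpolyXU_exp_homog F v 1).
  have [k2 e2q] := curve_line_homog b2 c2 q_hom.
  exists (k1 * k + r * k2); rewrite LM Lq Lv /e1 /e2 /= e1v e2q.
  by rewrite -!mul_polyC polyCD !polyCM expr1 exprS; ring.
move=> p_hom; rewrite (mpolyE p) linear_sum /= big_seq.
elim/big_rec: _ => [|m q mp [k ->]]; first by exists 0; rewrite scale0r.
have <- : mdeg m = d by have /dhomogP := p_hom; apply.
suff [k' Lm] : exists k', L 'X_[m] = k' *: 'X^(mdeg m).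
  by exists (p@_m * k' + k); rewrite linearZ /= Lm scalerDl scalerA.
have -> : mdeg m = addn (m 0) (m 1).
  by rewrite mdegE big_ord_recl big_ord1 (_ : lift ord0 ord0 = 1) //; apply: val_inj.
rewrite mpolyX2; elim: (m 0) => [|j IHj].
  rewrite mul1r add0n; elim: (m 1) => [|j IHj].
    by exists 0; rewrite expr0 -mpolyC1 (LC LM) scale0r.
  by rewrite exprS; apply: LXM Lz _ IHj; apply: mpolyXU_exp_homog.
rewrite exprS -mulrA addSn; apply: LXM Ly _ IHj.
by apply: dhomogM; apply: mpolyXU_exp_homog.
Qed.

Variable a : nat -> F.
Hypotheses (lam0 : lam != 0) (mu0 : a 1 * b1 + c1 != 0).
Hypotheses (a10 : a 1 != 0) (delta0 : a 2 + a 1 ^+ 2 != 0)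
  (a1sq : a 1 ^+ 2 != a 2).

Let e1Q k : e1 (Q a k) = (a k * b1 ^+ k + c1 ^+ k) *: 'X^k.
Proof. by rewrite /e1 /= curveQ !exprZn scalerA scalerDl. Qed.

Let e1Q1 : e1 (Q a 1) = (a 1 * b1 + c1) *: 'X.
Proof. exact: e1Q. Qed.

Let e1C c : e1 c%:MP = c%:P.
Proof. exact: curveC. Qed.

Theorem cohen_macaulay_of_kernel : (forall k, (0 < k)%N -> L (Q a k) = 0) ->
  cohen_macaulay (Lambda_ring a) /\ hilbert_series_eq a h_num h_den.
Proof.
move=> LQ; split.
  exact: Lambda_cohen_macaulay e1C e1Q1 (e1Q 2) LM Ly LQ lam0 mu0 a10 delta0 a1sq.
apply: Lambda_hilbert_series e1Q1 LM Ly lam0 mu0 twisted_der_homog _.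
exact: Lambda_kerL e1C e1Q1 (e1Q 2) LM Ly LQ lam0 mu0 a10 delta0 a1sq.
Qed.

(** If L Q_n is nonzero, then for k >= n so is L g for g = Q_1^(k-n) Q_n. A form of degree k differs
    from a multiple of g by an element of ker L, so it lies in Lambda. *)
Theorem kernel_of_cohen_macaulay : (forall k, (0 < k <= 3)%N -> L (Q a k) = 0) ->
  cohen_macaulay (Lambda_ring a) -> forall n, (0 < n)%N -> L (Q a n) = 0.
Proof.
move=> LQ CM n n_gt0; apply: contrapT => LQn.
apply: (Lambda_not_cohen_macaulay (n := n) a10) CM => k p lenk p_hom.
have [r Lp] := twisted_der_homog p_hom.
have [s LQs] := twisted_der_homog (Q_homog a n).
have s0 : s != 0 by apply: contra_not_neq LQn => s0; rewrite LQs s0 scale0r.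
pose mu := a 1 * b1 + c1; pose g := Q a 1 ^+ (k - n) * Q a n.
have gL : g \in Lambda a by rewrite rpredM ?rpredX ?Q_Lambda.
have Lg : L g = (mu ^+ (k - n) * s) *: 'X^k.
  have LQ1 : L (Q a 1 ^+ (k - n)) = 0.
    by rewrite -phiXC -phiXn (Lphi LM LQ).
  rewrite /g LM LQ1 mul0r addr0 LQs (rmorphXn e1) e1Q1 exprZn -scalerAl -scalerAr scalerA.
  by rewrite -exprD subnK.
have ms0 : mu ^+ (k - n) * s != 0 by rewrite mulf_neq0 ?expf_neq0.
have Lpg : L (p - (r / (mu ^+ (k - n) * s))%:MP * g) = 0.
  by rewrite linearB /= mul_mpolyC linearZ /= Lg Lp scalerA divfK ?subrr.
rewrite -(subrK ((r / (mu ^+ (k - n) * s))%:MP * g) p).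
apply: rpredD; last by rewrite rpredM ?mpolyC_Lambda.
exact: kerL_Lambda e1C e1Q1 (e1Q 2) LM Ly LQ lam0 mu0 a10 delta0 a1sq _ Lpg.
Qed.

End LinePair.

Lemma curve_linear (F : fieldType) (u v : {poly F}) : linear (curve u v).
Proof.
by move=> k p q; rewrite rmorphD -mul_mpolyC rmorphM /= curveC mul_polyC.
Qed.

(** * The (q,t) family *)

Section QT.
Variables (F : numClosedFieldType) (q t c : F).

(** The factor [1 *: 'X] keeps the shape of the lines in the preceding section. *)
Definition qt_form (p : {mpoly F[2]}) : {poly F} :=
  curve (c^-1 *: 'X) (1 *: 'X) p - curve ((t / c) *: 'X) (q *: 'X) p.

Fact qt_form_is_linear : linear qt_form.
Proof.
by move=> k p r; rewrite /qt_form !curve_linear scalerBr opprD addrACA.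
Qed.

HB.instance Definition _ :=
  GRing.isLinear.Build F {mpoly F[2]} {poly F} *:%R qt_form qt_form_is_linear.

Hypotheses (c0 : c != 0) (q_nru : not_root_of_unity q) (t_nru : not_root_of_unity t).
Hypotheses (tq : t != q) (qt1 : q * t != 1).

Let qk k : (0 < k)%N -> q ^+ k - 1 != 0.
Proof. by move=> /q_nru; rewrite unity_rootE subr_eq0. Qed.

Let tk k : (0 < k)%N -> 1 - t ^+ k != 0.
Proof. by move=> /t_nru; rewrite unity_rootE subr_eq0 eq_sym. Qed.

Lemma qt_formM p r : qt_form (p * r) =
  curve (c^-1 *: 'X) (1 *: 'X) p * qt_form r + qt_form p * curve ((t / c) *: 'X) (q *: 'X) r.
Proof. by rewrite /qt_form !rmorphM /=; ring. Qed.

Lemma qt_form_y : qt_form y = ((1 - t) / c) *: 'X.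
Proof. by rewrite /qt_form !curve_y -scalerBl mulrBl mul1r. Qed.

Lemma qt_form_z : qt_form z = (1 - q) *: 'X.
Proof. by rewrite /qt_form !curve_z -scalerBl. Qed.

Variable a : nat -> F.

(** The coefficient of x^k is affine in a_k with slope (1 - t^k) / c^k, nonzero as t is not a root
    of unity. *)
Lemma qt_formQ k : (0 < k)%N ->
  (qt_form (Q a k) == 0) = (a k == c ^+ k * ((q ^+ k - 1) / (1 - t ^+ k))).
Proof.
move=> k_gt0; rewrite /qt_form !curveQ !exprZn !scalerA -!scalerDl -scalerBl.
rewrite scaler_eq0 expf_eq0 polyX_eq0 andbF orbF exprVn expr_div_n expr1n.
have t0 := tk k_gt0; have ck0 : c ^+ k != 0 by rewrite expf_neq0.
have -> : a k * (c ^+ k)^-1 + 1 - (a k * (t ^+ k / c ^+ k) + q ^+ k) =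
  (1 - t ^+ k) / c ^+ k * (a k - c ^+ k * ((q ^+ k - 1) / (1 - t ^+ k))).
  by field; rewrite t0 ck0.
by rewrite mulf_eq0 (negPf (mulf_neq0 t0 _)) ?invr_eq0 // subr_eq0.
Qed.

Hypothesis aE : forall k, (0 < k <= 2)%N -> a k = c ^+ k * ((q ^+ k - 1) / (1 - t ^+ k)).

(** The factor q - t appears in a_1 / c + 1 and in a_2 + a_1^2, the factor q t - 1 in a_1^2 -
    a_2. *)
Lemma qt_nondegenerate : [/\ (1 - t) / c != 0, a 1 * c^-1 + 1 != 0, a 1 != 0,
  a 2 + a 1 ^+ 2 != 0 & a 1 ^+ 2 != a 2].
Proof.
have t1 : 1 - t != 0 := tk (ltn0Sn 0); have q1 : q - 1 != 0 := qk (ltn0Sn 0).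
have t2 := tk (ltn0Sn 1); have q2 := qk (ltn0Sn 1).
have two0 : 2 != 0 :> F by rewrite pnatr_eq0.
have tq0 : q - t != 0 by rewrite subr_eq0 eq_sym.
have qt0 : q * t - 1 != 0 by rewrite subr_eq0.
rewrite !aE // !expr1; split.
- by rewrite mulf_neq0 ?invr_eq0.
- have -> : c * ((q - 1) / (1 - t)) / c + 1 = (q - t) / (1 - t) by field; rewrite ?t1 ?t2 ?c0.
  by rewrite mulf_neq0 ?invr_eq0.
- by rewrite !mulf_neq0 ?invr_eq0.
- have -> : c ^+ 2 * ((q ^+ 2 - 1) / (1 - t ^+ 2)) + (c * ((q - 1) / (1 - t))) ^+ 2 =
    c ^+ 2 * (q - 1) / (1 - t) * (2 * (q - t) / (1 - t ^+ 2)) by field; rewrite ?t1 ?t2 ?c0.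
  by rewrite !mulf_neq0 ?invr_eq0 ?expf_neq0.
- rewrite -subr_eq0.
  have -> : (c * ((q - 1) / (1 - t))) ^+ 2 - c ^+ 2 * ((q ^+ 2 - 1) / (1 - t ^+ 2)) =
    c ^+ 2 * (q - 1) / (1 - t) * (2 * (q * t - 1) / (1 - t ^+ 2)) by field; rewrite ?t1 ?t2 ?c0.
  by rewrite !mulf_neq0 ?invr_eq0 ?expf_neq0.
Qed.

Theorem qt_cohen_macaulay :
  (forall k, (0 < k)%N -> a k = c ^+ k * ((q ^+ k - 1) / (1 - t ^+ k))) ->
  cohen_macaulay (Lambda_ring a) /\ hilbert_series_eq a h_num h_den.
Proof.
move=> akE; have [? ? ? ? ?] := qt_nondegenerate.
apply: (cohen_macaulay_of_kernel qt_formM qt_form_y qt_form_z) => // k k_gt0.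
by apply/eqP; rewrite qt_formQ // akE.
Qed.

Theorem qt_of_cohen_macaulay :
  a 3 = c ^+ 3 * ((q ^+ 3 - 1) / (1 - t ^+ 3)) -> cohen_macaulay (Lambda_ring a) ->
  forall k, (0 < k)%N -> a k = c ^+ k * ((q ^+ k - 1) / (1 - t ^+ k)).
Proof.
move=> a3E CM k k_gt0; have [? ? ? ? ?] := qt_nondegenerate.
apply/eqP; rewrite -qt_formQ //; apply/eqP.
apply: (kernel_of_cohen_macaulay qt_formM qt_form_y qt_form_z) CM _ k_gt0 => //.
move=> j /andP[j_gt0 j_le3]; apply/eqP; rewrite qt_formQ //; apply/eqP.
by case: j j_gt0 j_le3 => [|[|[|[|]]]] // _ _; apply: aE.
Qed.

End QT.

(** * The confluent family *)

Section Confluent.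
Variables (F : numClosedFieldType) (al c : F).

(** The first-order term in e of the (q,t) form at t = 1 - e, q = 1 + al e: a derivative in the
    direction (1/c, - al), with the factor x restoring the degree. *)
Definition confl_form (p : {mpoly F[2]}) : {poly F} :=
  'X * curve (c^-1 *: 'X) (1 *: 'X) (c^-1 *: p^`M(0) - al *: p^`M(1)).

Fact confl_form_is_linear : linear confl_form.
Proof.
move=> k p r; rewrite /confl_form scalerAr -mulrDr -curve_linear; congr (_ * curve _ _ _).
by rewrite !mderivD !mderivZ -!mul_mpolyC; ring.
Qed.

HB.instance Definition _ :=
  GRing.isLinear.Build F {mpoly F[2]} {poly F} *:%R confl_form confl_form_is_linear.

Hypothesis c0 : c != 0.

Lemma confl_formM p r : confl_form (p * r) =
  curve (c^-1 *: 'X) (1 *: 'X) p * confl_form r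
  + confl_form p * curve (c^-1 *: 'X) (1 *: 'X) r.
Proof.
rewrite /confl_form; set e := curve _ _; rewrite mulrCA mulrAC -mulrA -mulrDr.
rewrite -!rmorphM -rmorphD; congr (_ * e _).
by rewrite !mderivM -!mul_mpolyC; ring.
Qed.

Lemma confl_form_y : confl_form y = c^-1 *: 'X.
Proof.
by rewrite /confl_form !mderivU /= scaler0 subr0 -mul_mpolyC mulr1 curveC mulrC mul_polyC.
Qed.

Lemma confl_form_z : confl_form z = - al *: 'X.
Proof.
rewrite /confl_form !mderivU /= scaler0 sub0r -mul_mpolyC mulr1 -mpolyCN curveC.
by rewrite mulrC mul_polyC.
Qed.

Variable a : nat -> F.

Lemma confl_formQ k : (0 < k)%N -> (confl_form (Q a k) == 0) = (a k == c ^+ k * al).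
Proof.
move=> k_gt0.
have yk j : confl_form (y ^+ j) = (j%:R * c^-1 ^+ j) *: 'X^j.
  elim: j => [|j IHj]; first by rewrite mul0r scale0r expr0 -mpolyC1 (LC confl_formM).
  rewrite exprS confl_formM IHj confl_form_y rmorphXn /= !curve_y exprZn.
  by rewrite -!mul_polyC !polyCM !exprS !polyCM -natr1 polyCD; ring.
have zk j : confl_form (z ^+ j) = - (j%:R * al) *: 'X^j.
  elim: j => [|j IHj]; first by rewrite mul0r oppr0 scale0r expr0 -mpolyC1 (LC confl_formM).
  rewrite exprS confl_formM IHj confl_form_z rmorphXn /= !curve_z exprZn expr1n.
  by rewrite -!mul_polyC !exprS !polyCN !polyCM -natr1 polyCD; ring.
rewrite /Q linearD linearZ /= yk zk scalerA -scalerDl.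
rewrite scaler_eq0 expf_eq0 polyX_eq0 andbF orbF exprVn.
have ck0 : c ^+ k != 0 by rewrite expf_neq0.
have -> : a k * (k%:R / c ^+ k) - k%:R * al = k%:R / c ^+ k * (a k - c ^+ k * al).
  by field.
by rewrite !mulf_eq0 invr_eq0 (negPf ck0) pnatr_eq0 eqn0Ngt k_gt0 subr_eq0.
Qed.

Hypotheses (al0 : al != 0) (al1 : al != 1) (alN1 : al != -1).
Hypothesis aE : forall k, (0 < k <= 2)%N -> a k = c ^+ k * al.

(** The factor al + 1 governs a_1 / c + 1 and a_2 + a_1^2, the factor al - 1 governs a_1^2 - a_2. *)
Lemma confl_nondegenerate : [/\ c^-1 != 0, a 1 * c^-1 + 1 != 0, a 1 != 0,
  a 2 + a 1 ^+ 2 != 0 & a 1 ^+ 2 != a 2].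
Proof.
have alp : al + 1 != 0 by rewrite -[1]opprK subr_eq0.
have alm : al - 1 != 0 by rewrite subr_eq0.
rewrite !aE // !expr1; split.
- by rewrite invr_eq0.
- by rewrite mulrAC mulfV // mul1r.
- by rewrite mulf_neq0.
- have -> : c ^+ 2 * al + (c * al) ^+ 2 = c ^+ 2 * al * (al + 1) by ring.
  by rewrite !mulf_neq0 ?expf_neq0.
- rewrite -subr_eq0; have -> : (c * al) ^+ 2 - c ^+ 2 * al = c ^+ 2 * al * (al - 1) by ring.
  by rewrite !mulf_neq0 ?expf_neq0.
Qed.

Theorem confl_cohen_macaulay : (forall k, (0 < k)%N -> a k = c ^+ k * al) ->
  cohen_macaulay (Lambda_ring a) /\ hilbert_series_eq a h_num h_den.
Proof.
move=> akE; have [? ? ? ? ?] := confl_nondegenerate.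
apply: (cohen_macaulay_of_kernel confl_formM confl_form_y confl_form_z) => // k k_gt0.
by apply/eqP; rewrite confl_formQ // akE.
Qed.

Theorem confl_of_cohen_macaulay :
  a 3 = c ^+ 3 * al -> cohen_macaulay (Lambda_ring a) ->
  forall k, (0 < k)%N -> a k = c ^+ k * al.
Proof.
move=> a3E CM k k_gt0; have [? ? ? ? ?] := confl_nondegenerate.
apply/eqP; rewrite -confl_formQ //; apply/eqP.
apply: (kernel_of_cohen_macaulay confl_formM confl_form_y confl_form_z) CM _ k_gt0 => //.
move=> j /andP[j_gt0 j_le3]; apply/eqP; rewrite confl_formQ //; apply/eqP.
by case: j j_gt0 j_le3 => [|[|[|[|]]]] // _ _; apply: aE.
Qed.

End Confluent.

Theorem theorem2p4 (R : realType) :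
  (* (i) *)
  (forall (q t c : R[i]) (a : nat -> R[i]),
     not_root_of_unity q -> not_root_of_unity t -> t != q -> q * t != 1 ->
     c != 0 ->
     (forall i, (0 < i)%N -> a i = c ^+ i * ((q ^+ i - 1) / (1 - t ^+ i))) ->
     cohen_macaulay (Lambda_ring a) /\ hilbert_series_eq a h_num h_den) /\
  (* (ii) *)
  (forall (a : nat -> R[i]) (c q t : R[i]),
     (forall i, (0 < i)%N -> a i != 0) ->
     not_root_of_unity q -> not_root_of_unity t -> t != q -> q * t != 1 ->
     (forall i, (0 < i <= 3)%N ->
        a i = c ^+ i * ((q ^+ i - 1) / (1 - t ^+ i))) ->
     cohen_macaulay (Lambda_ring a) ->
     forall i, (0 < i)%N -> a i = c ^+ i * ((q ^+ i - 1) / (1 - t ^+ i))) /\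
  (* (iii) *)
  (forall (c alpha : R[i]) (a : nat -> R[i]),
     c != 0 -> alpha != 0 -> alpha != 1 -> alpha != -1 ->
     (forall i, (0 < i)%N -> a i = c ^+ i * alpha) ->
     cohen_macaulay (Lambda_ring a) /\ hilbert_series_eq a h_num h_den) /\
  (* (iv) *)
  (forall (a : nat -> R[i]) (c alpha : R[i]),
     (forall i, (0 < i)%N -> a i != 0) ->
     alpha != 1 -> alpha != -1 ->
     (forall i, (0 < i <= 3)%N -> a i = c ^+ i * alpha) ->
     cohen_macaulay (Lambda_ring a) ->
     forall i, (0 < i)%N -> a i = c ^+ i * alpha).
Proof.
split; [|split; [|split]].
- move=> q t c a q_nru t_nru tq qt1 c0 aE.
  apply: (qt_cohen_macaulay c0 q_nru t_nru tq qt1) => // k /andP[k_gt0 _].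
  exact: aE.
- move=> a c q t a0 q_nru t_nru tq qt1 aE.
  have c0 : c != 0.
    by have := a0 1%N isT; rewrite aE // expr1 mulf_eq0 negb_or => /andP[].
  apply: (qt_of_cohen_macaulay c0 q_nru t_nru tq qt1) => [k /andP[k_gt0 k_le2]|].
    by apply: aE; rewrite k_gt0 ltnW.
  exact: aE.
- move=> c al a c0 al0 al1 alN1 aE.
  by apply: (confl_cohen_macaulay c0 al0 al1 alN1) => // k /andP[/aE].
- move=> a c al a0 al1 alN1 aE.
  have : c * al != 0 by have := a0 1%N isT; rewrite aE.
  rewrite mulf_eq0 negb_or => /andP[c0 al0].
  apply: (confl_of_cohen_macaulay c0 al0 al1 alN1) => [k /andP[k_gt0 k_le2]|].
    by apply: aE; rewrite k_gt0 ltnW.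
  exact: aE.
Qed.
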